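(* Let $G$ be a planar Tanner graph with bit node set $V^b$ and check node set $V^c$, representing a code with rate $R=1-|V^c|/|V^b|\ge 5/8$ and minimum distance $d$. Then $$d\le \left\lceil \frac{7-8R}{2(2R-1)} \right\rceil + 3.$$
   Context: A Tanner graph $G$ is a finite simple bipartite graph with vertex set $V^b\cup V^c$ ($V^b$: bit nodes, $V^c$: check nodes) and edge set $E(G)\subseteq V^b\times V^c$. It defines the binary linear code of all $x\in\mathbb{F}_2^{V^b}$ such that for each check node $v_c$ the sum of $x_{v_b}$ over all bit nodes $v_b$ adjacent to $v_c$ is $0$. The rate of the code defined by $G$ is taken to be $R=1-|V^c|/|V^b|$. The minimum distance is the minimum Hamming weight of a nonzero codeword. $G$ is planar if it is planar as a graph. $\lceil x\rceil$ is the smallest integer $\ge x$. *)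

(* Defs.v *)
From HB Require Import structures.
From mathcomp Require Import all_boot all_order all_algebra.
From mathcomp Require Import all_classical all_reals all_analysis.
Import Order.TTheory GRing.Theory Num.Theory numFieldNormedType.Exports.

Set Implicit Arguments.
Unset Strict Implicit.
Unset Printing Implicit Defensive.

Local Open Scope classical_set_scope.
Local Open Scope ring_scope.

Section Planarity.
Variables (R : realType) (V : finType).

(* [e] is meant to be symmetric and irreflexive. *)
Definition edge_set (e : rel V) : {set {set V}} :=
  [set [set x; y]%SET | x in V, y in V & e x y]%SET.

Definition plane_arc (g : R -> R * R) : Prop :=
  {within `[0, 1], continuous g} /\ {in `[0, 1] &, injective g}.

(* A crossing-free drawing in the plane R^2: [p] places the vertices, and
   [g A] parametrizes over [0, 1] the curve that represents the edge [A]. *)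
Definition plane_drawing (e : rel V) (p : V -> R * R)
    (g : {set V} -> R -> R * R) : Prop :=
  [/\ injective p,
      forall A : {set V}, A \in edge_set e ->
        plane_arc (g A) /\ [set g A 0; g A 1] = [set p x | x in [set` A]],
      forall (A : {set V}) z, A \in edge_set e -> ~ (g A @` `]0, 1[) (p z)
    & forall A B : {set V}, A \in edge_set e -> B \in edge_set e -> A <> B ->
        (g A @` `]0, 1[) `&` (g B @` `]0, 1[) = set0].

Definition planar (e : rel V) : Prop := exists p g, plane_drawing e p g.

End Planarity.

(* A Tanner graph is given by its bit nodes [Vb], its check nodes [Vc] and its
   edges [E]; the disjoint sum [Vb + Vc] is its vertex set. *)
Section Tanner.
Variables (Vb Vc : finType) (E : {set Vb * Vc}).

Definition tanner_rel : rel (Vb + Vc) := fun u v =>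
  match u, v with
  | inl b, inr c | inr c, inl b => (b, c) \in E
  | _, _ => false
  end.

Definition tanner_code : {set {ffun Vb -> 'F_2}} :=
  [set x : {ffun Vb -> 'F_2} |
    [forall c : Vc, \sum_(b | (b, c) \in E) x b == 0]]%SET.

Definition weight (x : {ffun Vb -> 'F_2}) : nat := #|[set b | x b != 0]%SET|.

Definition is_min_distance (d : nat) : Prop :=
  (exists x, [/\ x \in tanner_code, x != 0 & weight x = d]) /\
  (forall x, x \in tanner_code -> x != 0 -> (d <= weight x)%N).

End Tanner.

(* This is the design rate; the code may have a larger dimension. For [Vb] empty
   the value is 1 by convention, but then there is no minimum distance. *)
Definition rate (R : realType) (Vb Vc : finType) : R :=
  1 - #|Vc|%:R / #|Vb|%:R.

Arguments planar R {V} e.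

(* Main.v *)
(* Planarity enters only through Euler's formula, which is transported from a
   grid.  On a fine enough square grid, the nodes near the arcs of a drawing
   contain a model of the Tanner graph as a minor (up to contracting connected
   sets of nodes and deleting grid edges), so no Jordan curve theorem is needed.
   Deleting edges merges faces and contracting edges merges vertices, and this
   bookkeeping preserves |E| + 2 <= |V| + |F| and the evenness of the face
   boundaries.  Distributing weights over the edges then gives, for subgraphs
   of the Tanner graph, linear inequalities between the numbers of bits of each
   degree, provided that the even edge sets of small weight are excluded by the
   minimum distance.

   Let U be the set of checks that have a bit of degree 1 and let Y be the other
   checks.  If the neighbours of a bit e of degree 2 are among those of a bit b of
   degree 3, then {e, b} has as syndrome a single check, and so have certain sets
   made of a bit of degree 2 or 3 and of bits of degree 1.  Two such sets with the
   same syndrome add up to a codeword, so for large d there are at most |Y| of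
   them.  Euler's formula for the whole graph and for the graph induced on Y both
   need many nested pairs (e, b) when there are many bits; together with the girth
   bound for the bits of degree 2, this is contradictory as soon as d exceeds the
   stated value. *)
From HB Require Import structures.
From mathcomp Require Import all_boot zify.

Set Implicit Arguments.
Unset Strict Implicit.
Unset Printing Implicit Defensive.

(** * Faces of minors of plane graphs *)

Section Multigraph.
Variables (V E : finType) (s t : E -> V).
Implicit Types (K : {set E}) (P R : {set V}).

(** Serves the primal graph and also its dual, with faces as vertices and the two sides of an edge
    as its ends. *)
Definition edge_adj K : rel V := fun x y =>
  [exists e in K, (s e == x) && (t e == y) || (s e == y) && (t e == x)].

Definition edge_cut P : {set E} := [set e | (s e \in P) != (t e \in P)].

Lemma edge_adj_sym K : connect_sym (edge_adj K).
Proof.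
by apply: sym_connect_sym => x y; apply: eq_existsb => e; rewrite orbC.
Qed.

Lemma edge_adj1 K e : e \in K -> edge_adj K (s e) (t e).
Proof. by move=> Ke; apply/existsP; exists e; rewrite Ke !eqxx. Qed.

Lemma edge_adj_closed K P : [disjoint edge_cut P & K] -> closed (edge_adj K) P.
Proof.
move=> dPK x y /existsP[e /andP[Ke ends]].
have : e \notin edge_cut P by apply/negP => /(disjointFr dPK); rewrite Ke.
rewrite inE negbK => /eqP.
by case/orP: ends => /andP[/eqP <- /eqP <-].
Qed.

Lemma connect_constant K P x y :
  [disjoint edge_cut P & K] -> connect (edge_adj K) x y -> (x \in P) = (y \in P).
Proof. by move=> /edge_adj_closed/closed_connect; apply. Qed.

Lemma connect_invariant K P x y :
  (forall e, e \in K -> (s e \in P) = (t e \in P)) ->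
  connect (edge_adj K) x y -> (x \in P) = (y \in P).
Proof.
move=> KP; apply: connect_constant; rewrite disjoint_sym disjoint_subset.
by apply/subsetP => e /KP st; rewrite !inE st eqxx.
Qed.

Lemma component_cut K x :
  [disjoint edge_cut [set y | connect (edge_adj K) x y] & K].
Proof.
rewrite disjoint_subset; apply/subsetP => e; rewrite !inE.
apply: contraNN => Ke.
by rewrite (same_connect_r (@edge_adj_sym K) (connect1 (edge_adj1 Ke))).
Qed.

Lemma component_invariant K x e : e \in K ->
  connect (edge_adj K) x (s e) = connect (edge_adj K) x (t e).
Proof.
by move=> Ke; apply: (same_connect_r (@edge_adj_sym K)); apply/connect1/edge_adj1.
Qed.

Lemma connect_subset K K' x y :
  K \subset K' -> connect (edge_adj K) x y -> connect (edge_adj K') x y.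
Proof.
move=> sKK'; apply: connect_sub => a b /existsP[e /andP[Ke ends]].
by apply/connect1/existsP; exists e; rewrite (subsetP sKK').
Qed.

(* A vertex set is determined by its cut edges in [K] and its trace on [R]. *)
Lemma card_vertices_le K R :
    (forall x, exists2 y, y \in R & connect (edge_adj K) x y) ->
  #|V| <= #|K| + #|R|.
Proof.
move=> toR; pose f P := (edge_cut P :&: K, P :&: R).
have f_inj : injective f.
  move=> P Q [eqK eqR].
  (* Equal cuts in [K] make agreement of [P] and [Q] invariant along [K], and every component meets
     [R], where they agree. *)
  pose A := [set x | (x \in P) == (x \in Q)].
  have dAK : [disjoint edge_cut A & K].
    rewrite disjoint_subset; apply/subsetP => e; rewrite !inE.
    apply: contraNN => Ke; have := congr1 (fun X : {set E} => e \in X) eqK.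
    rewrite !inE Ke !andbT.
    by case: (s e \in P); case: (t e \in P); case: (s e \in Q); case: (t e \in Q).
  apply/setP => x; have [y Ry xy] := toR x.
  have := congr1 (fun X : {set V} => y \in X) eqR; rewrite !inE Ry !andbT => yPQ.
  have := connect_constant dAK xy; rewrite !inE yPQ eqxx.
  by move=> /eqP.
have : #|[set f P | P in powerset [set: V]]|
    <= #|setX (powerset K) (powerset R)|.
  apply/subset_leq_card/subsetP => _ /imsetP[P _ ->].
  by rewrite inE !powersetE !subsetIr.
rewrite card_imset // cardsX !card_powerset cardsT -expnD.
by rewrite leq_exp2l.
Qed.

End Multigraph.

(** * Euler's formula and face boundaries after contraction and deletion *)

Section FaceBasis.
Variables (V E F : finType) (s t : E -> V) (l r : E -> F).
Hypothesis cut_parity : forall P A, ~~ odd #|edge_cut s t P :&: edge_cut l r A|.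
Hypothesis primal_connected :
  forall P, edge_cut s t P = set0 -> P != set0 -> P = setT.
Hypothesis dual_connected :
  forall A, edge_cut l r A = set0 -> A != set0 -> A = setT.
Hypothesis euler : #|E| + 2 <= #|V| + #|F|.

Variables (I J : finType) (S : I -> {set V}) (a b : J -> I) (i0 : I).
Hypothesis S_neq0 : forall i, S i != set0.
Hypothesis S_disjoint : forall i i' x, x \in S i -> x \in S i' -> i = i'.
Hypothesis S_connected : forall i (P : {set V}),
  (forall e, s e \in S i -> t e \in S i -> (s e \in P) = (t e \in P)) ->
  forall x y, x \in S i -> y \in S i -> x \in P -> y \in P.
Hypothesis a_neq_b : forall j, a j != b j.
Hypothesis ab_inj : forall j j', [set a j; b j] = [set a j'; b j'] -> j = j'.
Hypothesis ab_linked : forall j, exists e,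
  (s e \in S (a j)) && (t e \in S (b j)) ||
  (s e \in S (b j)) && (t e \in S (a j)).

Let con K := connect (edge_adj s t K).

(* [K] is a minimal set of edges that still connects every vertex to some branch
   set, inside a maximal set of edges that does not join two branch sets. *)
Lemma spanning_edges : exists (K : {set E}) (lab : V -> I),
  [/\ #|V| <= #|K| + #|I|,
      forall e, e \in K -> lab (s e) = lab (t e),
      forall i x, x \in S i -> lab x = i
    & forall e, e \in K -> exists2 P : {set V},
        P != set0 & edge_cut s t P :&: K = [set e]].
Proof.
have [rep repP] : exists rep : I -> V, forall i, rep i \in S i.
  apply: (@fin_all_exists I (fun=> V) (fun i x => x \in S i)) => i.
  by have /set0Pn[x] := S_neq0 i; exists x.
pose sep K := [forall i, forall i', con K (rep i) (rep i') ==> (i == i')].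
have sepP K i i' : sep K -> con K (rep i) (rep i') -> i = i'.
  by move=> /forallP/(_ i)/forallP/(_ i')/implyP h c; apply/eqP/h.
(* Starting from the edges inside branch sets keeps every branch set within one component. *)
pose K0 := [set e | [exists i, (s e \in S i) && (t e \in S i)]].
have sepK0 : sep K0.
  apply/forallP => i; apply/forallP => i'; apply/implyP => cii'.
  have dSK : [disjoint edge_cut s t (S i) & K0].
    rewrite disjoint_subset; apply/subsetP => e; rewrite !inE.
    apply: contraNN => /existsP[k /andP[sk tk]].
    suff -> : (s e \in S i) = (t e \in S i) by [].
    apply/idP/idP => [si|ti].
      by rewrite (S_disjoint si sk).
    by rewrite (S_disjoint ti tk).
  have := connect_constant dSK cii'; rewrite repP => /esym/S_disjoint.
  by move=> /(_ _ (repP i'))/eqP.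
have [K1 /maxsetP[sepK1 maxK1] sK01] := maxset_exists sepK0.
pose covers K := [forall x, exists i, con K x (rep i)].
have coversK1 : covers K1.
  apply/forallP => x; apply: contraT; rewrite negb_exists => /forallP xN.
  (* A component of [K1] without representatives has an outgoing edge [e]; adding [e] still
     separates the representatives, against maximality. *)
  pose P := [set y | con K1 x y].
  have Px : x \in P by rewrite inE; exact: connect0.
  have PN i : rep i \notin P by rewrite inE.
  have /set0Pn[e eP] : edge_cut s t P != set0.
    apply/negP => /eqP/primal_connected PT.
    have := PN i0; rewrite PT ?inE //.
    by apply/set0Pn; exists x.
  have eNK1 : e \notin K1.
    by rewrite (disjointFr (component_cut s t K1 x) eP).
  suff sepK2 : sep (e |: K1).
    by have := maxK1 _ sepK2 (subsetUr _ _) => eK; rewrite -eK setU11 in eNK1.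
  apply/forallP => i; apply/forallP => i'; apply/implyP => cii'.
  pose Q := [set y | con K1 (rep i) y].
  have dPQ y : ~~ ((y \in P) && (y \in Q)).
    rewrite !inE; apply: contra (xN i) => /andP[xy iy].
    by rewrite /con (connect_trans xy) // edge_adj_sym.
  have dQ : [disjoint edge_cut s t Q & K1] by exact: component_cut.
  have dP : [disjoint edge_cut s t P & K1] by exact: component_cut.
  (* The component of [rep i] once [e] is added: it gains [P] exactly when [e] joins [P] to [Q]. *)
  pose Q' := if e \in edge_cut s t Q then Q :|: P else Q.
  have dQ' : [disjoint edge_cut s t Q' & e |: K1].
    rewrite disjoint_subset; apply/subsetP => f.
    rewrite 2!inE in_setU1 negb_or => fQ'; apply/andP; split.
      apply: contraTneq fQ' => ->; rewrite /Q'.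
      move: eP (dPQ (s e)) (dPQ (t e)).
      rewrite [_ \in edge_cut s t P]inE [_ \in edge_cut s t Q]inE.
      case: ifPn; rewrite !inE.
        by case: (con K1 x _); case: (con K1 x _); case: (con K1 (rep i) _);
          case: (con K1 (rep i) _).
      by rewrite negbK => /eqP->; rewrite eqxx.
    apply: contraTN fQ' => fK1; have := disjointFl dQ fK1.
    have := disjointFl dP fK1; rewrite /Q'.
    case: ifP => _; rewrite !inE.
      by move=> /negbFE/eqP-> /negbFE/eqP->; rewrite negbK.
    by move=> _ ->.
  have Q'i : rep i \in Q'.
    rewrite /Q'; have Qi : rep i \in Q by rewrite inE; exact: connect0.
    by case: ifP => // _; rewrite in_setU Qi.
  have := connect_constant dQ' cii'; rewrite Q'i /Q' => /esym.
  have Qi' : rep i' \in Q -> i == i' by rewrite inE => /(sepP _ _ _ sepK1)/eqP.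
  case: ifP => // _; rewrite in_setU (negbTE (PN i')) orbF; exact: Qi'.
have [K /minsetP[coversK minK] sK1] := minset_exists coversK1.
have [lab labP] : exists lab : V -> I, forall x, con K x (rep (lab x)).
  apply: (@fin_all_exists V (fun=> I) (fun x i => con K x (rep i))) => x.
  by have /forallP/(_ x)/existsP[i] := coversK; exists i.
exists K, lab; split.
- apply: leq_trans (card_vertices_le (s := s) (t := t) (K := K)
      (R := [set rep i | i in I]) _) _.
    by move=> x; exists (rep (lab x)); [exact: imset_f | exact: labP].
  by rewrite leq_add2l leq_imset_card.
- move=> e Ke; apply: (sepP K1) => //; apply: (connect_subset sK1).
  rewrite -/(con K _ _).
  apply: (@connect_trans _ _ (s e)); first by rewrite edge_adj_sym; exact: labP.
  exact: connect_trans (connect1 (edge_adj1 s t Ke)) (labP (t e)).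
- move=> i x Sx; apply/esym/(sepP K1) => //.
  apply: (@connect_trans _ _ x); last exact: connect_subset sK1 (labP x).
  apply: (connect_subset sK01); rewrite edge_adj_sym.
  have := @S_connected i [set y | con K0 x y] _ x (rep i) Sx (repP i).
  rewrite !inE; apply; last exact: connect0.
  move=> e Sse Ste; rewrite !inE.
  apply: (same_connect_r (@edge_adj_sym _ _ s t K0)).
  apply/connect1/edge_adj1; rewrite inE; apply/existsP; exists i.
  by rewrite Sse.
- move=> e Ke.
  (* By minimality some [v] reaches no representative without [e]. Its component in [K :\ e] is
     crossed by [e], as otherwise [v] would reach none in [K] either. *)
  have : ~~ covers (K :\ e).
    apply/negP => /minK/(_ (subsetDl _ _)) eK.
    by have := Ke; rewrite -eK !inE eqxx.
  rewrite negb_forall => /existsP[v]; rewrite negb_exists => /forallP vN.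
  pose P := [set y | con (K :\ e) v y].
  have dP : [disjoint edge_cut s t P & K :\ e] by exact: component_cut.
  exists P; first by apply/set0Pn; exists v; rewrite inE; exact: connect0.
  apply/setP => f; rewrite !inE; apply/andP/eqP => [[fP Kf]|->].
    apply/eqP; apply: contraTT fP => fe.
    have fKe : f \in K :\ e by rewrite !inE fe Kf.
    by have := disjointFl dP fKe; rewrite !inE => ->.
  split=> //; apply/negP => eP.
  have dPK : [disjoint edge_cut s t P & K].
    rewrite disjoint_sym disjoint_subset; apply/subsetP => g Kg.
    have [->|ge] := eqVneq g e; first by rewrite !inE negbK.
    have gKe : g \in K :\ e by rewrite !inE ge Kg.
    by rewrite inE (disjointFl dP gKe).
  have := connect_constant dPK (labP v); rewrite !inE (negbTE (vN _)).
  by move=> /negbT/negP; apply; exact: connect0.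
Qed.

(** A face of the minor is a class of faces merged across the deleted edges [D]; [Phi] holds one
    root per class and [z x] is the boundary. Contracting [K] loses at most [#|K|] vertices and
    deleting [D] at most [#|D|] faces, which preserves Euler's inequality. [cut_parity] is the
    combinatorial form of planarity and yields the evenness. *)
Lemma face_family : exists (Phi : {set F}) (z : F -> {set J}),
  [/\ #|J| + 2 <= #|I| + #|Phi|,
      forall x i, ~~ odd #|[set j in z x | (a j == i) || (b j == i)]|,
      forall j, #|[set x in Phi | j \in z x]| <= 2,
      1 < #|Phi| -> forall x, x \in Phi -> z x != set0
    & 2 < #|Phi| -> {in Phi &, injective z}].
Proof.
have [K [lab [leV labK labS bridge]]] := spanning_edges.
have [ed edP] := @fin_all_exists J (fun=> E) _ ab_linked.
have lab_ed j : (lab (s (ed j)) = a j /\ lab (t (ed j)) = b j)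
             \/ (lab (s (ed j)) = b j /\ lab (t (ed j)) = a j).
  by case/orP: (edP j) => /andP[/labS-> /labS->]; [left|right].
have ed_inj : injective ed.
  move=> j j' ejj'; apply: ab_inj.
  have ab_lab k : [set a k; b k] = [set lab (s (ed k)); lab (t (ed k))].
    by have [[-> ->]|[-> ->]] := lab_ed k; rewrite // setUC.
  by rewrite !ab_lab ejj'.
have edNK j : ed j \notin K.
  apply/negP => /labK; have := a_neq_b j.
  by case: (lab_ed j) => -[-> ->] /eqP // ab /esym.
pose D := ~: (K :|: [set ed j | j in J]).
have cardE : #|E| = #|K| + #|J| + #|D|.
  rewrite -(cardsC (K :|: [set ed j | j in J])) cardsU card_imset //.
  suff -> : K :&: [set ed j | j in J] = set0 by rewrite cards0 subn0.
  apply/setP => e; rewrite !inE; apply/negP => /andP[Ke /imsetP[j _ eE]].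
  by have := edNK j; rewrite -eE Ke.
have dualC := @edge_adj_sym _ _ l r D.
pose dcon := connect (edge_adj l r D).
pose Phi := [set x | root (edge_adj l r D) x == x].
pose comp x := [set y | dcon x y].
pose z x := [set j | ed j \in edge_cut l r (comp x)].
have compD x : [disjoint edge_cut l r (comp x) & D] by exact: component_cut.
have rootP x y : x \in Phi -> y \in comp x -> root (edge_adj l r D) y = x.
  by rewrite !inE => /eqP xE /(rootP dualC) <-.
have leF : #|F| <= #|D| + #|Phi|.
  apply: (card_vertices_le (s := l) (t := r)) => x.
  exists (root (edge_adj l r D) x); last exact: connect_root.
  by rewrite inE root_root.
(* A bridge of [K] whose dual edge crosses [A] would be the only edge
   crossing both a vertex set and [A]. *)
have crossed A : [disjoint edge_cut l r A & D] -> A != set0 -> A != setT ->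
    exists j, ed j \in edge_cut l r A.
  move=> dAD A0 AT; apply/existsP; apply: contraT.
  rewrite negb_exists => /forallP edN.
  have AK e : e \in edge_cut l r A -> e \in K.
    move=> eA; have := disjointFr dAD eA.
    rewrite !inE => /negbFE/orP[//|/imsetP[j _ eE]].
    by have := edN j; rewrite -eE eA.
  have /set0Pn[e eA] : edge_cut l r A != set0.
    by apply: contra AT => /eqP/dual_connected ->.
  have [P _ PK] := bridge _ (AK _ eA).
  have := cut_parity P A.
  suff -> : edge_cut s t P :&: edge_cut l r A = [set e] by rewrite cards1.
  apply/setP => f; rewrite in_setI in_set1; apply/andP/eqP => [[fP fA]|->].
    by apply/set1P; rewrite -PK in_setI fP AK.
  by split => //; have := set11 e; rewrite -PK in_setI => /andP[].
exists Phi, z; split.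
- by move: euler leV leF; rewrite cardE; lia.
- move=> x i; pose P := [set v | lab v == i].
  have := cut_parity P (comp x).
  (* Edges of [K] have equal labels at both ends and edges of [D] have both sides in one class, so
     only the chosen edges [ed j] cross both. *)
  suff -> : edge_cut s t P :&: edge_cut l r (comp x)
      = [set ed j | j in [set j in z x | (a j == i) || (b j == i)]].
    by rewrite card_imset.
  have edPi j : (ed j \in edge_cut s t P) = (a j == i) || (b j == i).
    have ne p q : p != q -> ((p == i) != (q == i)) = (p == i) || (q == i).
      by case: (eqVneq p i) => [->|_]; case: (eqVneq q i).
    rewrite !inE; case: (lab_ed j) => -[-> ->]; first by rewrite ne ?a_neq_b.
    by rewrite ne 1?orbC // eq_sym a_neq_b.
  apply/setP => e; rewrite in_setI; apply/andP/imsetP => [[eP eA]|[j + ->]].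
    have := disjointFr (compD x) eA; rewrite !inE => /negbFE/orP[Ke|].
      by move: eP; rewrite !inE (labK _ Ke) eqxx.
    move=> /imsetP[j _ eE]; exists j => //.
    by rewrite inE -edPi -eE eP andbT inE -eE.
  by rewrite inE -edPi inE => /andP[-> ->].
- move=> j; apply: (@leq_trans #|[set root (edge_adj l r D) (l (ed j));
      root (edge_adj l r D) (r (ed j))]|); last first.
    by rewrite cards2; case: eqP.
  apply/subset_leq_card/subsetP => x; rewrite in_set => /andP[xPhi].
  rewrite in_set [_ \in edge_cut _ _ _]in_set in_set2.
  have [lx _|_] := boolP (l (ed j) \in comp x).
    by rewrite (rootP _ _ xPhi lx) eqxx.
  by have [rx _|//] := boolP (r (ed j) \in comp x);
     rewrite (rootP _ _ xPhi rx) eqxx orbT.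
- move=> Phi2 x xPhi.
  have x0 : comp x != set0 by apply/set0Pn; exists x; rewrite inE; exact: connect0.
  have xT : comp x != setT.
    apply: contraTneq Phi2 => cT; rewrite -leqNgt.
    rewrite -(cards1 x); apply/subset_leq_card/subsetP => y yPhi.
    have yx : root (edge_adj l r D) y = x.
      by apply: (rootP x y xPhi); rewrite cT in_setT.
    by move: yPhi; rewrite !inE yx eq_sym.
  have [j jx] := crossed _ (compD x) x0 xT.
  by apply/set0Pn; exists j; rewrite inE.
- move=> Phi3 x y xPhi yPhi zE; apply/eqP; apply: contraT => xNy.
  (* Classes with equal boundaries have a union that no [ed j] crosses; a third class makes this
     union proper, contrary to [crossed]. *)
  pose A := comp x :|: comp y.
  have xyN w : w \in comp x -> w \in comp y -> False.
    by move=> /(rootP _ _ xPhi) wx /(rootP _ _ yPhi); rewrite wx; apply/eqP.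
  have dA : [disjoint edge_cut l r A & D].
    rewrite disjoint_sym disjoint_subset; apply/subsetP => e De.
    rewrite inE; move: (disjointFl (compD x) De) (disjointFl (compD y) De).
    by rewrite !in_set => /negbFE/eqP-> /negbFE/eqP->; rewrite eqxx.
  have A0 : A != set0.
    by apply/set0Pn; exists x; rewrite !inE /dcon connect0.
  have AT : A != setT.
    apply: contraTneq Phi3 => cT; rewrite -leqNgt.
    apply: (@leq_trans #|[set x; y]|); last by rewrite cards2; case: eqP.
    apply/subset_leq_card/subsetP => w wPhi.
    have : w \in A by rewrite cT in_setT.
    rewrite /A in_setU.
    have wE : root (edge_adj l r D) w = w by move: wPhi; rewrite inE => /eqP.
    by case/orP => [/(rootP _ _ xPhi)|/(rootP _ _ yPhi)];
      rewrite wE => ->; rewrite !inE eqxx ?orbT.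
  have [j] := crossed _ dA A0 AT.
  have := congr1 (fun X : {set J} => j \in X) zE.
  have := xyN (l (ed j)); have := xyN (r (ed j)); rewrite !in_set.
  case: (dcon x _); case: (dcon y _); case: (dcon x _); case: (dcon y _) => //=
    xyr xyl.
  all: by [case: (xyr isT isT) | case: (xyl isT isT)].
Qed.
End FaceBasis.

Lemma odd_card_bigaddb (T : finType) (A : {set T}) :
  odd #|A| = \big[addb/false]_x (x \in A).
Proof.
rewrite -sum1_card (big_morph odd oddD (erefl _)) big_mkcond.
by apply: eq_bigr => x _; case: ifP.
Qed.

(** * The square grid as a plane graph *)

Section Grid.
Variable n : nat.

Definition grid_node : predArgType := ('I_n.+1 * 'I_n.+1)%type.
Definition grid_edge : predArgType := ('I_n * 'I_n.+1 + 'I_n.+1 * 'I_n)%type.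
Definition grid_face : predArgType := option ('I_n * 'I_n).
HB.instance Definition _ := Finite.on grid_node.
HB.instance Definition _ := Finite.on grid_edge.
HB.instance Definition _ := Finite.on grid_face.

Definition node (i j : nat) : grid_node := (inord i, inord j).

(* [None] is the outer face, which also absorbs out of range indices. *)
Definition face (i j : nat) : grid_face :=
  match insub i : option 'I_n, insub j : option 'I_n with
  | Some a, Some b => Some (a, b)
  | _, _ => None
  end.

Definition face_below (i j : nat) := if j is k.+1 then face i k else None.
Definition face_left (i j : nat) := if i is k.+1 then face k j else None.

Definition grid_src (e : grid_edge) : grid_node :=
  match e with inl (i, j) => node i j | inr (i, j) => node i j end.
Definition grid_tgt (e : grid_edge) : grid_node :=
  match e with inl (i, j) => node i.+1 j | inr (i, j) => node i j.+1 end.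
(** Connectedness of the induced subgraph, phrased through invariant sets instead of paths. *)
Definition node_connected (S : {set grid_node}) := forall P : {set grid_node},
  (forall e, grid_src e \in S -> grid_tgt e \in S ->
    (grid_src e \in P) = (grid_tgt e \in P)) ->
  forall v w, v \in S -> w \in S -> v \in P -> w \in P.

Definition grid_fst_face (e : grid_edge) : grid_face :=
  match e with inl (i, j) => face i j | inr (i, j) => face i j end.
Definition grid_snd_face (e : grid_edge) : grid_face :=
  match e with inl (i, j) => face_below i j | inr (i, j) => face_left i j end.

Lemma nodeK (x : grid_node) : node x.1 x.2 = x.
Proof. by case: x => i j; rewrite /node !inord_val. Qed.

(** Summation by parts over the field with two elements; both boundary terms vanish. *)
Lemma big_addb_shift (H h : nat -> bool) : h n = false ->
  \big[addb/false]_(j < n.+1)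
    (H j && (h j (+) (if val j is k.+1 then h k else false)))
  = \big[addb/false]_(j < n) ((H j (+) H j.+1) && h j).
Proof.
move=> hn; under eq_bigr do rewrite andb_addr.
rewrite big_split /= big_ord_recr big_ord_recl /= hn !andbF addbF addFb -big_split.
by apply: eq_bigr => j _; rewrite andb_addl.
Qed.

(** Summation by parts moves the differences from the faces to the nodes; the four node differences
    around a unit square add up to 0. *)
Lemma grid_parity P A : ~~ odd
  #|edge_cut grid_src grid_tgt P :&: edge_cut grid_fst_face grid_snd_face A|.
Proof.
pose p i j := node i j \in P.
(* Adding the value at the outer face does not change the cut and makes [h] vanish outside the
   grid. *)
pose h i j := (face i j \in A) (+) (None \in A).
have h_out i j : (n <= i) || (n <= j) -> h i j = false.
  rewrite /h /face; case: insubP => [a ? ai|_ _]; last by rewrite addbb.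
  by case: insubP => [b ? bj|_ _]; [lia | rewrite addbb].
rewrite odd_card_bigaddb big_sumType /=.
have pairE (X Y : finType) (f : X * Y -> bool) :
    \big[addb/false]_x f x = \big[addb/false]_i \big[addb/false]_j f (i, j).
  by rewrite pair_bigA; apply: eq_bigr => -[].
rewrite !pairE.
pose dH i j := p i j (+) p i.+1 j; pose dV i j := p i j (+) p i j.+1.
have -> : \big[addb/false]_(i < n) \big[addb/false]_(j < n.+1)
    (inl (i, j) \in edge_cut grid_src grid_tgt P
       :&: edge_cut grid_fst_face grid_snd_face A)
  = \big[addb/false]_(i < n) \big[addb/false]_(j < n)
    ((dH i j (+) dH i j.+1) && h i j).
  apply: eq_bigr => i _; rewrite -(big_addb_shift (dH i)); last first.
    by rewrite h_out ?leqnn ?orbT.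
  apply: eq_bigr => j _; rewrite !inE /= /dH /p /h !negb_eqb.
  congr (_ && _); case: j => -[|j] ? /=; first by rewrite addbF.
  by rewrite addbACA addbb addbF.
have -> : \big[addb/false]_(i < n.+1) \big[addb/false]_(j < n)
    (inr (i, j) \in edge_cut grid_src grid_tgt P
       :&: edge_cut grid_fst_face grid_snd_face A)
  = \big[addb/false]_(i < n) \big[addb/false]_(j < n)
    ((dV i j (+) dV i.+1 j) && h i j).
  rewrite exchange_big [RHS]exchange_big /=.
  apply: eq_bigr => j _.
  rewrite -(big_addb_shift (dV^~ j) (h := h^~ j)); last by rewrite h_out ?leqnn.
  apply: eq_bigr => i _; rewrite !inE /= /dV /p /h !negb_eqb.
  congr (_ && _); case: i => -[|i] ? /=; first by rewrite addbF.
  by rewrite addbACA addbb addbF.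
rewrite -big_split big1 // => i _; rewrite -big_split big1 // => j _ /=.
rewrite -andb_addl /dH /dV.
by case: (p i j); case: (p i.+1 j); case: (p i j.+1); case: (p i.+1 j.+1).
Qed.

Lemma grid_connected P :
  edge_cut grid_src grid_tgt P = set0 -> P != set0 -> P = setT.
Proof.
move=> /setP cut0.
have H i j : i < n -> j <= n -> (node i.+1 j \in P) = (node i j \in P).
  move=> lin ljn; have := cut0 (inl (Ordinal lin, Ordinal (ljn : j < n.+1))).
  by rewrite !inE /= => /negbFE/eqP.
have W i j : i <= n -> j < n -> (node i j.+1 \in P) = (node i j \in P).
  move=> lin ljn; have := cut0 (inr (Ordinal (lin : i < n.+1), Ordinal ljn)).
  by rewrite !inE /= => /negbFE/eqP.
have P00 i j : i <= n -> j <= n -> (node i j \in P) = (node 0 0 \in P).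
  move=> lin; elim: j => [|j IHj] ljn; last by rewrite W ?IHj // ltnW.
  by elim: i lin => [//|i IHi] lin; rewrite H ?IHi // ltnW.
have PE x : (x \in P) = (node 0 0 \in P).
  by rewrite -(nodeK x) P00 // -ltnS.
move=> /set0Pn[x]; rewrite PE => P0.
by apply/setP => y; rewrite PE P0 inE.
Qed.

Lemma grid_dual_connected A :
  edge_cut grid_fst_face grid_snd_face A = set0 -> A != set0 -> A = setT.
Proof.
move=> /setP cut0.
have B i j : i < n -> j <= n -> (face i j \in A) = (face_below i j \in A).
  move=> lin ljn; have := cut0 (inl (Ordinal lin, Ordinal (ljn : j < n.+1))).
  by rewrite !inE /= => /negbFE/eqP.
have AN i j : i < n -> j <= n -> (face i j \in A) = (None \in A).
  by move=> lin; elim: j => [|j IHj] ljn; rewrite B //= IHj // ltnW.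
have AE x : (x \in A) = (None \in A).
  case: x => [[i j]|//]; rewrite -(AN i j) // ?(ltnW (ltn_ord j)) //.
  by rewrite /face !valK.
move=> /set0Pn[x]; rewrite AE => A0.
by apply/setP => y; rewrite AE A0 inE.
Qed.

Lemma grid_euler : #|grid_edge| + 2 <= #|grid_node| + #|grid_face|.
Proof.
by rewrite card_option !card_prod card_sum !card_prod !card_ord; lia.
Qed.

End Grid.

(** * Euler's formula for Tanner graphs, with weights *)

Section WeightBound.
Variables (Vb Vc : finType) (n : nat) (S : Vb + Vc -> {set grid_node n}).
Variable E : {set Vb * Vc}.

Definition tanner_model :=
  [/\ forall v, S v != set0,
      forall u v x, x \in S u -> x \in S v -> u = v,
      forall v, node_connected (S v)
    & forall q, q \in E -> exists e : grid_edge n,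
        (grid_src e \in S (inl q.1)) && (grid_tgt e \in S (inr q.2)) ||
        (grid_src e \in S (inr q.2)) && (grid_tgt e \in S (inl q.1))].

(** The elements of the binary cycle space. *)
Definition even_edges (z : {set Vb * Vc}) :=
  (forall b, ~~ odd #|[set q in z | q.1 == b]|) /\
  (forall c, ~~ odd #|[set q in z | q.2 == c]|).

Variables (B : {set Vb}) (Y : {set Vc}) (M : {set Vb * Vc}).
Hypotheses (model : tanner_model) (ME : M \subset E).
Hypothesis MBY : forall q, q \in M -> (q.1 \in B) /\ (q.2 \in Y).

(** This is [face_family] in the grid, with the branch sets of [B] and [Y] as vertices and [M] as
    edge set; an edge of [M] provides the vertex required there. *)
Lemma tanner_faces : M != set0 ->
  exists (T : finType) (Phi : {set T}) (z : T -> {set Vb * Vc}),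
  [/\ #|M| + 2 <= #|B| + #|Y| + #|Phi|,
      forall x, z x \subset M /\ even_edges (z x),
      forall q, #|[set x in Phi | q \in z x]| <= 2,
      1 < #|Phi| -> forall x, x \in Phi -> z x != set0
    & 2 < #|Phi| -> {in Phi &, injective z}].
Proof.
case: model => S0 Sdisj Sconn Slink /set0Pn[q0 q0M].
pose I := ({b | b \in B} + {c | c \in Y})%type; pose J := {q | q \in M}.
pose vtx (i : I) : Vb + Vc :=
  match i with inl b => inl (val b) | inr c => inr (val c) end.
have vtx_inj : injective vtx.
  by case=> [[x ?]|[x ?]] [[y ?]|[y ?]] // [xy]; congr (_ _); apply: val_inj.
pose a (j : J) : I := inl (exist _ (val j).1 (MBY (valP j)).1).
pose b (j : J) : I := inr (exist _ (val j).2 (MBY (valP j)).2).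
have [||||||T [z [leJ zev z2 z0 zinj]]] := @face_family _ _ _
  (@grid_src n) (@grid_tgt n) (@grid_fst_face n) (@grid_snd_face n)
  (@grid_parity n) (@grid_connected n) (@grid_dual_connected n) (@grid_euler n)
  I J (fun i => S (vtx i)) a b (a (exist _ q0 q0M)).
- by move=> i; exact: S0.
- by move=> i i' x xi xi'; apply/vtx_inj/(Sdisj _ _ x).
- by move=> i P eP x y; exact: Sconn.
- by [].
- move=> j j' eqj; apply: val_inj.
  rewrite /= (surjective_pairing (val j)) (surjective_pairing (val j')).
  have : a j \in [set a j'; b j'] by rewrite -eqj set21.
  rewrite in_set2 => /orP[/eqP[->]|/eqP//].
  have : b j \in [set a j'; b j'] by rewrite -eqj set22.
  by rewrite in_set2 => /orP[/eqP//|/eqP[->]].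
- by move=> j; apply: Slink; apply: (subsetP ME); exact: valP.
pose zq x := [set val j | j in z x].
have zq_inj : injective (fun X : {set J} => [set val j | j in X]).
  exact/imset_inj/val_inj.
exists (grid_face n), T, zq; split.
- by move: leJ; rewrite card_sum !card_sig.
- move=> x; split; first by apply/subsetP => _ /imsetP[j _ ->]; exact: valP.
  split=> v.
    have [vB|vNB] := boolP (v \in B).
      have := zev x (inl (exist _ v vB)).
      rewrite -(card_imset _ val_inj); congr (~~ odd #|pred_of_set _|).
      apply/setP => q; rewrite inE.
      apply/imsetP/andP => [[j]|[/imsetP[j jz qE] qv]].
        rewrite inE => /andP[jz]; rewrite orbF => /eqP[jv] ->.
        by rewrite imset_f //= jv eqxx.
      exists j => //; rewrite inE jz orbF; apply/eqP; congr inl.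
      by apply: val_inj => /=; rewrite -qE; apply/eqP.
    rewrite (_ : [set _ in _ | _] = set0) ?cards0 //.
    apply/setP => q; rewrite !inE; apply/negP => /andP[/imsetP[j _ ->] /eqP jv].
    by have := (MBY (valP j)).1; rewrite jv (negbTE vNB).
  have [vY|vNY] := boolP (v \in Y).
    have := zev x (inr (exist _ v vY)).
    rewrite -(card_imset _ val_inj); congr (~~ odd #|pred_of_set _|).
    apply/setP => q; rewrite inE.
    apply/imsetP/andP => [[j]|[/imsetP[j jz qE] qv]].
      rewrite inE => /andP[jz /= /eqP[jv]] ->.
      by rewrite imset_f //= jv eqxx.
    exists j => //; rewrite inE jz /=; apply/eqP; congr inr.
    by apply: val_inj => /=; rewrite -qE; apply/eqP.
  rewrite (_ : [set _ in _ | _] = set0) ?cards0 //.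
  apply/setP => q; rewrite !inE; apply/negP => /andP[/imsetP[j _ ->] /eqP jv].
  by have := (MBY (valP j)).2; rewrite jv (negbTE vNY).
- move=> q; have [qM|qNM] := boolP (q \in M).
    apply: leq_trans (z2 (exist _ q qM)); apply/subset_leq_card/subsetP => x.
    rewrite !inE => /andP[-> /imsetP[j jz qE]] /=.
    by rewrite (_ : exist _ _ _ = j) //; apply: val_inj.
  rewrite (_ : [set _ in _ | _] = set0) ?cards0 //.
  apply/setP => x; rewrite !inE; apply/negP => /andP[_ /imsetP[j _ qE]].
  by have := valP j; rewrite -qE (negbTE qNM).
- move=> T2 x xT; have /set0Pn[j jz] := z0 T2 x xT.
  by apply/set0Pn; exists (val j); exact: imset_f.
- by move=> T3 x y xT yT /zq_inj; exact: zinj.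
Qed.

(** Double counting: an edge lies on at most two boundaries, and a boundary weighs at least [c], up
    to a deficit [k] if it is in [X]. Distinct faces have distinct boundaries, so the total deficit
    is at most [k * #|X|]; Euler's formula does the rest. *)
Lemma weight_bound (w : Vb * Vc -> nat) (X : {set {set Vb * Vc}}) (k c : nat) :
    (forall z : {set Vb * Vc}, z \subset M -> z != set0 -> even_edges z ->
       c <= \sum_(q in z) w q + k * (z \in X)) ->
  c * #|M| <= c * (#|B| + #|Y|) + 2 * \sum_(q in M) w q + k * #|X|.
Proof.
move=> heavy; have [->|M0] := eqVneq M set0; first by rewrite cards0 muln0.
have [T [Phi [z [euler zM z2 z0 zinj]]]] := tanner_faces M0.
(* With at most two faces Euler's formula alone suffices; from three on the boundaries are nonempty
   and distinct. *)
have [Phi2|Phi3] := leqP #|Phi| 2.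
  have : #|M| <= #|B| + #|Y| by lia.
  by rewrite -addnA => /(leq_mul (leqnn c))/leq_trans; apply; rewrite leq_addr.
suff : c * #|Phi| <= 2 * \sum_(q in M) w q + k * #|X|.
  have := leq_mul (leqnn c) euler; rewrite !mulnDr; lia.
have : c * #|Phi| <= \sum_(x in Phi) (\sum_(q in z x) w q + k * (z x \in X)).
  rewrite mulnC -sum_nat_const; apply: leq_sum => x xPhi.
  have [zx ev] := zM x; apply: heavy => //.
  by apply: z0 => //; exact: ltnW.
move=> /leq_trans; apply; rewrite big_split /=; apply: leq_add.
  have -> : \sum_(x in Phi) \sum_(q in z x) w q
      = \sum_(q in M) \sum_(x in Phi | q \in z x) w q.
    rewrite (exchange_big_dep (mem M)) //= => x q _.
    by have [/subsetP zx _] := zM x; exact: zx.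
  rewrite big_distrr /=; apply: leq_sum => q _.
  rewrite sum_nat_const leq_mul2r; apply/orP; right.
  by apply: leq_trans (z2 q); apply/subset_leq_card/subsetP => x; rewrite inE.
rewrite -big_distrr /= leq_mul2l; apply/orP; right.
rewrite -big_mkcondr /= sum1_card.
have -> : #|[pred x in Phi | z x \in X]|
    = #|[set z x | x in [pred x in Phi | z x \in X]]|.
  rewrite card_in_imset // => x y /andP[xP _] /andP[yP _].
  exact: zinj.
by apply/subset_leq_card/subsetP => _ /imsetP[x /andP[_ xX] ->].
Qed.

End WeightBound.

(** * Discharging with weights that depend on the bit *)

Section BitWeights.
Variables (Vb Vc : finType).
Implicit Types (z : {set Vb * Vc}) (b : Vb) (c : Vc).

Definition row z b : {set Vc} := [set c | (b, c) \in z].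
Definition column z c : {set Vb} := [set b | (b, c) \in z].

Lemma sum_rows z (u : Vb -> nat) : \sum_(q in z) u q.1 = \sum_b u b * #|row z b|.
Proof.
rewrite big_mkcond (eq_bigr (fun q => if (q.1, q.2) \in z then u q.1 else 0)).
  rewrite -(pair_bigA _ (fun b c => if (b, c) \in z then u b else 0)) /=.
  apply: eq_bigr => b _; rewrite -big_mkcond sum_nat_const mulnC; congr (_ * _).
  by apply: eq_card => c; rewrite [LHS]/= inE.
by move=> [].
Qed.

Lemma even_row z b : even_edges z -> ~~ odd #|row z b|.
Proof.
move=> [/(_ b) + _].
rewrite -(card_imset (row z b) (f := pair b)); last by move=> ? ? [].
congr (~~ odd #|pred_of_set _|); apply/setP => -[b' c]; rewrite !inE /=.
apply/andP/imsetP => [[bz /eqP bb]|[c' + [-> ->]]]; last by rewrite inE.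
by exists c; rewrite ?inE -bb.
Qed.

Lemma even_column z c : even_edges z -> ~~ odd #|column z c|.
Proof.
move=> [_ /(_ c)].
rewrite -(card_imset (column z c) (f := pair^~ c)); last by move=> ? ? [].
congr (~~ odd #|pred_of_set _|); apply/setP => -[b c']; rewrite !inE /=.
apply/andP/imsetP => [[bz /eqP bb]|[b' + [-> ->]]]; last by rewrite inE.
by exists b; rewrite ?inE -bb.
Qed.

Variables (n : nat) (S : Vb + Vc -> {set grid_node n}) (E : {set Vb * Vc}).
Hypothesis model : tanner_model S E.
Variables (B : {set Vb}) (Y : {set Vc}) (N : Vb -> {set Vc}).
Hypothesis NE : forall b c, b \in B -> c \in N b -> (b, c) \in E /\ c \in Y.

Let M : {set Vb * Vc} := [set q | (q.1 \in B) && (q.2 \in N q.1)].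

Let row_M b : row M b = if b \in B then N b else set0.
Proof. by apply/setP => c; rewrite !inE /=; case: ifP; rewrite ?inE. Qed.

Lemma bit_weight_bound (u : Vb -> nat) (X : {set {set Vb * Vc}}) (k c : nat) :
    (forall z, z != set0 -> (forall b, row z b \subset N b) ->
       (forall b, row z b != set0 -> b \in B) ->
       even_edges z -> c <= \sum_b u b * #|row z b| + k * (z \in X)) ->
  c * \sum_(b in B) #|N b| <=
    c * (#|B| + #|Y|) + 2 * \sum_(b in B) u b * #|N b| + k * #|X|.
Proof.
move=> heavy.
have sumM (v : Vb -> nat) : \sum_(q in M) v q.1 = \sum_(b in B) v b * #|N b|.
  rewrite sum_rows [RHS]big_mkcond; apply: eq_bigr => b _; rewrite row_M.
  by case: ifP => // _; rewrite cards0 muln0.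
have <- : #|M| = \sum_(b in B) #|N b|.
  rewrite -sum1_card (sumM (fun=> 1)).
  by apply: eq_bigr => b _; rewrite mul1n.
rewrite -sumM; apply: (weight_bound model).
- by apply/subsetP => -[b c']; rewrite inE /= => /andP[bB cN]; case: (NE bB cN).
- by move=> [b c']; rewrite inE /= => /andP[bB cN]; split => //; case: (NE bB cN).
move=> z zM z0 ev; rewrite sum_rows; apply: heavy => // b.
  apply/subsetP => c'; rewrite inE => /(subsetP zM).
  by rewrite inE => /andP[].
move=> /set0Pn[c']; rewrite inE => /(subsetP zM).
by rewrite inE => /andP[].
Qed.

Lemma row_gt1 z b : even_edges z -> row z b != set0 -> 1 < #|row z b|.
Proof.
by move=> /(even_row b); rewrite -card_gt0; case: #|_| => [|[]].
Qed.

Lemma other_row z b c : even_edges z -> c \in row z b ->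
  exists2 b', b' != b & c \in row z b'.
Proof.
move=> /(even_column c) ev; rewrite inE => bcz.
have bc : b \in column z c by rewrite inE.
have /set0Pn[b'] : column z c :\ b != set0.
  by rewrite -card_gt0; move: ev; rewrite (cardsD1 b) bc /=; case: #|_|.
by rewrite !inE => /andP[b'b b'z]; exists b'; rewrite ?inE.
Qed.

Lemma row_neq0 z : z != set0 -> exists b, row z b != set0.
Proof.
by move=> /set0Pn[[b c] bcz]; exists b; apply/set0Pn; exists c; rewrite inE.
Qed.

Lemma sum_row_ge z (u : Vb -> nat) (A : {set Vb}) :
  \sum_(b in A) u b * #|row z b| <= \sum_b u b * #|row z b|.
Proof. by rewrite [X in _ <= X](bigID (mem A)) /= leq_addr. Qed.

(** A nonempty even edge set has at least two edges at each of at least two bits, so faces have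
    length at least 4. *)
Lemma degree_sum_bound : \sum_(b in B) #|N b| <= 2 * #|B| + 2 * #|Y|.
Proof.
have sum1 : \sum_(b in B) 1 * #|N b| = \sum_(b in B) #|N b|.
  by apply: eq_bigr => b _; rewrite mul1n.
have := @bit_weight_bound (fun=> 1) set0 0 4.
suff heavy z : z != set0 -> (forall b, row z b \subset N b) ->
   (forall b, row z b != set0 -> b \in B) ->
   even_edges z -> 4 <= \sum_b 1 * #|row z b| + 0 * (z \in set0).
  by move=> /(_ heavy); rewrite sum1 cards0; lia.
move=> /row_neq0[b b0] _ _ ev; have /set0Pn[c bc] := b0.
have [b' b'b b'c] := other_row ev bc.
rewrite mul0n addn0; apply: leq_trans (sum_row_ge z (fun=> 1) [set b; b']).
rewrite big_setU1 ?inE 1?eq_sym // big_set1 !mul1n.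
have := row_gt1 ev b0; have : row z b' != set0 by apply/set0Pn; exists c.
move=> /(row_gt1 ev) b'2 b2.
by rewrite (leq_add (m1 := 2) (m2 := 2)).
Qed.

(** Bits of degree 2 act as edges of a graph on the checks: an even edge set uses both edges of each
    of its bits, so it has twice as many edges as bits. *)
Lemma girth_bound (g : nat) :
    (forall b, b \in B -> #|N b| = 2) ->
    (forall T : {set Vb}, T \subset B -> T != set0 ->
      (forall c, ~~ odd #|[set b in T | c \in N b]|) -> g <= #|T|) ->
  g * #|B| <= g * #|Y| + 2 * #|B|.
Proof.
move=> N2 girth.
have sum2 (v : Vb -> nat) :
    (forall b, b \in B -> v b = 2) -> \sum_(b in B) v b = 2 * #|B|.
  by move=> v2; rewrite (eq_bigr (fun=> 2)) // sum_nat_const mulnC.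
have := @bit_weight_bound (fun=> 1) set0 0 (2 * g).
rewrite cards0 !sum2 //; last by move=> b /N2 ->.
suff heavy z : z != set0 -> (forall b, row z b \subset N b) ->
   (forall b, row z b != set0 -> b \in B) ->
   even_edges z -> 2 * g <= \sum_b 1 * #|row z b| + 0 * (z \in set0).
  by move=> /(_ heavy); lia.
move=> z0 zN zB ev; rewrite mul0n addn0.
pose T := [set b | row z b != set0].
have TB : T \subset B by apply/subsetP => b; rewrite inE => /zB.
have rowT b : b \in T -> row z b = N b.
  rewrite inE => b0; apply/eqP; rewrite eqEcard zN N2 ?zB //.
  exact: row_gt1.
apply: leq_trans (sum_row_ge z (fun=> 1) T).
rewrite (eq_bigr (fun=> 2)); last first.
  by move=> b bT; rewrite mul1n rowT // N2 // (subsetP TB).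
rewrite sum_nat_const mulnC leq_mul2r; apply/orP; right.
apply: girth => //.
  by have [b b0] := row_neq0 z0; apply/set0Pn; exists b; rewrite inE.
move=> c; have := even_column c ev; congr (~~ odd #|pred_of_set _|).
apply/setP => b; rewrite [in LHS]inE [in RHS]inE.
have [bT|] := boolP (b \in T); first by rewrite -rowT // inE.
rewrite inE negbK => /eqP/setP/(_ c); rewrite !inE => ->.
by [].
Qed.

Definition nested_pairs : {set Vb * Vb} :=
  [set q | [&& q.1 \in B, q.2 \in B, #|N q.1| == 2, 2 < #|N q.2|
             & N q.1 \subset N q.2]].

(** The second hypothesis rules out short even sets made of bits of degree 2. The third lets a bit
    with more than three neighbours pay for its own nested pairs, so that only the pairs at bits
    with three neighbours remain. *)
Lemma nested_pairs_bound :
    (forall b, b \in B -> 1 < #|N b|) ->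
    (forall T : {set Vb}, T \subset B -> T != set0 ->
      (forall b, b \in T -> #|N b| = 2) ->
      (forall c, ~~ odd #|[set b in T | c \in N b]|) -> 3 < #|T|) ->
    (forall b, b \in B -> 3 < #|N b| ->
      #|[set e | (e, b) \in nested_pairs]| + 6 <= 2 * #|N b|) ->
  2 * #|B| <= 4 * #|Y| + #|[set q in nested_pairs | #|N q.2| == 3]|.
Proof.
move=> N2 light crowd.
(* In units of 1/8: an even set of edges has weight at least 1, except that the
   4-cycle of a nested pair has weight 3/4. *)
pose u b := if #|N b| == 2 then 1 else 2.
pose cyc (q : Vb * Vb) : {set Vb * Vc} :=
  [set r | ((r.1 == q.1) || (r.1 == q.2)) && (r.2 \in N q.1)].
have := @bit_weight_bound u [set cyc q | q in nested_pairs] 2 8.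
have heavy z : z != set0 -> (forall b, row z b \subset N b) ->
   (forall b, row z b != set0 -> b \in B) -> even_edges z ->
   8 <= \sum_b u b * #|row z b| + 2 * (z \in [set cyc q | q in nested_pairs]).
  move=> z0 zN zB ev.
  pose T2 := [set b | (row z b != set0) && (#|N b| == 2)].
  pose T3 := [set b | (row z b != set0) && (2 < #|N b|)].
  have in_T b : row z b != set0 -> (b \in T2) || (b \in T3).
    move=> b0; rewrite !inE b0 /=; have := N2 b (zB b b0).
    by rewrite leq_eqVlt eq_sym => ->.
  have rowT2 b : b \in T2 -> row z b = N b.
    rewrite inE => /andP[b0 /eqP Nb]; apply/eqP; rewrite eqEcard zN Nb.
    exact: row_gt1.
  have dT : [disjoint T2 & T3].
    rewrite -setI_eq0; apply/eqP/setP => b; rewrite !inE.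
    by case: (row z b != set0) => //=; lia.
  have sumT : 2 * #|T2| + \sum_(b in T3) 2 * #|row z b| <= \sum_b u b * #|row z b|.
    apply: leq_trans (sum_row_ge z u (T2 :|: T3)).
    rewrite (eq_bigl _ _ (fun b => in_setU b T2 T3)) bigU //=.
    apply: leq_add; last first.
      apply: leq_sum => b; rewrite inE => /andP[_ Nb].
      by rewrite /u; case: eqP => // Nb2; rewrite Nb2 in Nb.
    rewrite mulnC -sum_nat_const; apply: leq_sum => b bT.
    rewrite rowT2 //; move: bT; rewrite inE => /andP[_ /eqP Nb].
    by rewrite /u Nb.
  have sumT3 : 4 * #|T3| <= \sum_(b in T3) 2 * #|row z b|.
    rewrite mulnC -sum_nat_const; apply: leq_sum => b; rewrite inE => /andP[b0 _].
    exact: (@leq_mul 2 _ 2 _ (leqnn 2) (row_gt1 ev b0)).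
  (* Bits of [T2] contribute 2 and bits of [T3] at least 4. What can stay below 8 is one bit of [T3]
     with two edges beside at most one bit of [T2], or at most three bits of [T2] alone. *)
  have [T3_ge2|] := leqP 2 #|T3|; first by lia.
  rewrite ltnS leq_eqVlt ltnS leqn0 cards_eq0 => /orP[/cards1P[b' T3E]|/eqP T3E].
    have b'T : b' \in T3 by rewrite T3E set11.
    have b'0 : row z b' != set0 by move: b'T; rewrite inE => /andP[].
    move: sumT; rewrite T3E big_set1 => sumT.
    have rb' := row_gt1 ev b'0; have erb' := even_row b' ev.
    have [|rb'4] := leqP 4 #|row z b'|; first by lia.
    have {erb'} rb'2 : #|row z b'| = 2.
      by case: #|row z b'| rb' erb' rb'4 => [|[|[|[|]]]].
    have [|] := leqP 2 #|T2|; first by lia.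
    have T2_other c : c \in row z b' -> exists2 b, b \in T2 & c \in row z b.
      move=> cb'; have [b bb' cb] := other_row ev cb'; exists b => //.
      have : row z b != set0 by apply/set0Pn; exists c.
      by move=> /in_T; rewrite T3E in_set1 (negbTE bb') orbF.
    rewrite ltnS leq_eqVlt ltnS leqn0 cards_eq0.
    move=> /orP[/cards1P[e T2E]|/eqP T2E]; last first.
      have /set0Pn[c /T2_other[b]] := b'0.
      by rewrite T2E inE.
    have eT : e \in T2 by rewrite T2E set11.
    have eN : row z e = N e by exact: rowT2.
    have b'N : row z b' = N e.
      rewrite -eN; apply/setP => c; apply/idP/idP => [/T2_other[b]|ce].
        by rewrite T2E in_set1 => /eqP->.
      have [b be cb] := other_row ev ce.
      have : row z b != set0 by apply/set0Pn; exists c.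
      by move=> /in_T; rewrite T2E T3E !in_set1 (negbTE be) => /eqP <-.
    suff -> : z \in [set cyc q | q in nested_pairs].
      by move: sumT; rewrite T2E cards1; lia.
    apply/imsetP; exists (e, b').
      move: eT b'T; rewrite !inE => /andP[e0 Ne] /andP[_ Nb'] /=.
      by rewrite !zB // Ne Nb' -b'N zN.
    apply/setP => -[b c]; rewrite inE /=.
    have -> : ((b, c) \in z) = (c \in row z b) by rewrite inE.
    have [->|be] := eqVneq b e; first by rewrite eN.
    have [->|bb'] := eqVneq b b'; first by rewrite b'N.
    apply/negP => cb; have : row z b != set0 by apply/set0Pn; exists c.
    by move=> /in_T; rewrite T2E T3E !in_set1 (negbTE be) (negbTE bb').
  suff : 3 < #|T2| by lia.
  apply: light.
  - by apply/subsetP => b; rewrite inE => /andP[/zB].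
  - have [b /[dup] b0 /in_T] := row_neq0 z0; rewrite T3E in_set0 orbF => bT.
    by apply/set0Pn; exists b.
  - by move=> b; rewrite inE => /andP[_ /eqP].
  move=> c; have := even_column c ev; congr (~~ odd #|pred_of_set _|).
  apply/setP => b; rewrite [in LHS]inE [in RHS]inE.
  have [bT|bT] := boolP (b \in T2); first by rewrite -rowT2 // inE.
  apply/negP => bcz; have : row z b != set0 by apply/set0Pn; exists c; rewrite inE.
  by move=> /in_T; rewrite T3E in_set0 orbF (negbTE bT).
move=> /(_ heavy) main.
have leX : #|[set cyc q | q in nested_pairs]| <= #|nested_pairs|.
  exact: leq_imset_card.
pose p b := if 3 < #|N b| then #|[set e | (e, b) \in nested_pairs]| else 0.
(* Equality holds for two and for three neighbours, with 16 and 24 on each side; beyond three it is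
   twice [crowd]. *)
have per_bit : 12 * #|B| + 2 * \sum_(b in B) u b * #|N b| + 2 * \sum_(b in B) p b
    <= 8 * \sum_(b in B) #|N b|.
  rewrite mulnC -sum_nat_const !big_distrr /= -!big_split /=.
  apply: leq_sum => b bB; rewrite /u /p; have := N2 b bB; have := crowd b bB.
  by case: eqP => [->//|]; case: ltnP => //; lia.
have cardP : #|nested_pairs|
    = #|[set q in nested_pairs | #|N q.2| == 3]| + \sum_(b in B) p b.
  rewrite -(cardsID [set q | #|N q.2| == 3] nested_pairs).
  congr (#|pred_of_set _| + _).
    by apply/setP => q; rewrite !inE andbC.
  rewrite -sum1_card (partition_big snd (mem B)) /=; last first.
    by move=> q; rewrite !inE => /andP[_ /and5P[]].
  apply: eq_bigr => b bB; rewrite sum1_card /p.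
  case: ifPn => Nb.
    rewrite -(card_imset [set e | _] (f := pair^~ b)); last by move=> ? ? [].
    apply: eq_card => -[e b'].
    apply/andP/imsetP => [[+ /eqP /= bb]|[e' + [-> ->]]].
      by rewrite bb inE => /andP[_ ebP]; exists e; rewrite // inE.
    by rewrite !inE /= => /and5P[-> -> -> -> ->]; rewrite eqxx /=; lia.
  apply: eq_card0 => -[e b']; apply/negP => /andP[+ /eqP /= bb].
  by rewrite bb !inE /= => /andP[N3 /and5P[_ _ _ N2' _]]; lia.
move: main leX cardP per_bit.
set sN := \sum_(b in B) #|N b|; set su := \sum_(b in B) u b * _.
set sp := \sum_(b in B) p b; set X := [set cyc q | q in _].
set P3 := #|[set q in _ | _]|; move: sN su sp #|X| P3 => sN su sp cX P3.
lia.
Qed.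

End BitWeights.

(** * Counting bits by degree *)

Section SymmetricDifference.
Variable T : finType.
Implicit Types A B : {set T}.

Definition symdiff A B : {set T} := [set x | (x \in A) (+) (x \in B)].

Lemma symdiff_neq0 A B : A != B -> symdiff A B != set0.
Proof.
apply: contraNN => /eqP/setP AB; apply/eqP/setP => x; have := AB x.
by rewrite !inE => /negbT; rewrite -negb_eqb negbK => /eqP.
Qed.

Lemma symdiff_sub A B : symdiff A B \subset A :|: B.
Proof. by apply/subsetP => x; rewrite !inE; case: (x \in A). Qed.

Lemma card_symdiff A B : #|symdiff A B| <= #|A| + #|B|.
Proof.
by apply: leq_trans (subset_leq_card (symdiff_sub A B)) _; rewrite cardsU leq_subr.
Qed.

Lemma exists_subset_card A k :
  k <= #|A| -> exists2 B : {set T}, B \subset A & #|B| = k.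
Proof.
move=> kA; exists [set x in take k (enum A)].
  by apply/subsetP => x; rewrite inE => /mem_take; rewrite mem_enum.
rewrite cardsE (card_uniqP (take_uniq k (enum_uniq (mem A)))) size_takel //.
by rewrite -cardE.
Qed.

End SymmetricDifference.

(** * Syndromes of sets of bits *)

Section Syndrome.
Variables (Vb Vc : finType) (E : {set Vb * Vc}).
Implicit Types (X T : {set Vb}) (b : Vb) (c : Vc).

Definition nbr b : {set Vc} := [set c | (b, c) \in E].

Definition syndrome X : {set Vc} := [set c | odd #|[set b in X | c \in nbr b]|].

Lemma mem_syndrome X c :
  (c \in syndrome X) = \big[addb/false]_b ((b \in X) && (c \in nbr b)).
Proof.
by rewrite inE odd_card_bigaddb; apply: eq_bigr => b _; rewrite inE.
Qed.

Lemma syndrome_symdiff X X' :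
  syndrome (symdiff X X') = symdiff (syndrome X) (syndrome X').
Proof.
apply/setP => c; rewrite [RHS]inE !mem_syndrome -big_split.
by apply: eq_bigr => b _; rewrite inE andb_addl.
Qed.

Lemma syndrome1 b : syndrome [set b] = nbr b.
Proof.
apply/setP => c; rewrite mem_syndrome (bigD1 b) //= set11 big1 ?addbF //.
by move=> b' /negbTE b'b; rewrite in_set1 b'b.
Qed.

Lemma symdiff1 b b' : b != b' -> symdiff [set b] [set b'] = [set b; b'].
Proof.
move=> bb'; apply/setP => x; rewrite !inE.
by have [->|] := eqVneq x b; rewrite ?(negbTE bb') //.
Qed.

Lemma syndrome2 b b' : b != b' -> syndrome [set b; b'] = symdiff (nbr b) (nbr b').
Proof. by move=> bb'; rewrite -symdiff1 // syndrome_symdiff !syndrome1. Qed.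

Lemma odd_syndrome X : odd #|syndrome X| = \big[addb/false]_(b in X) odd #|nbr b|.
Proof.
rewrite odd_card_bigaddb (eq_bigr _ (fun c _ => mem_syndrome X c)) exchange_big.
rewrite [RHS]big_mkcond; apply: eq_bigr => b _ /=.
case: (b \in X); first by rewrite odd_card_bigaddb.
by rewrite big1.
Qed.

Lemma card_syndrome_le X U :
  #|syndrome X :&: U| <= \sum_(b in X) #|nbr b :&: U|.
Proof.
have : syndrome X :&: U \subset \bigcup_(b in X) (nbr b :&: U).
  apply/subsetP => c; rewrite in_setI => /andP[cX cU].
  have /set0Pn[b] : [set b in X | c \in nbr b] != set0.
    by apply: contraTneq cX => X0; rewrite inE X0 cards0.
  by rewrite inE => /andP[bX bc]; apply/bigcupP; exists b; rewrite // in_setI bc.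
move=> /subset_leq_card/leq_trans; apply.
elim/big_ind2: _ => [|A a B b Aa Bb|//]; first by rewrite cards0.
by apply: leq_trans (leq_add Aa Bb); rewrite cardsU leq_subr.
Qed.

(* Columns with even support inside [Q] span a space of dimension < #|Q|. *)
Lemma even_columns_dependent T (Q : {set Vc}) :
    Q != set0 -> (forall b, b \in T -> nbr b \subset Q /\ ~~ odd #|nbr b|) ->
    #|Q| <= #|T| ->
  exists X, [/\ X \subset T, X != set0 & syndrome X = set0].
Proof.
move=> /set0Pn[c0 c0Q] TQ leQT.
have synQ X : X \subset T -> syndrome X \subset Q.
  move=> XT; apply/subsetP => c; rewrite inE => odd_c.
  have /set0Pn[b] : [set b in X | c \in nbr b] != set0.
    by apply: contraTneq odd_c => ->; rewrite cards0.
  rewrite inE => /andP[bX bc].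
  by have [/subsetP nQ _] := TQ b (subsetP XT b bX); exact: nQ.
(* There are at most [2 ^ (#|Q| - 1)] values, so two subsets of [T] agree off [c0]; even degrees
   make the syndrome of their difference even, hence empty. *)
pose f X := syndrome X :\ c0.
have : ~~ dinjectiveb f (mem (powerset T)).
  apply/negP => /dinjectiveP/card_in_imset card_f.
  have : #|[set f X | X in powerset T]| <= #|powerset (Q :\ c0)|.
    apply/subset_leq_card/subsetP => _ /imsetP[X XT ->].
    by rewrite powersetE setSD // synQ // -powersetE.
  rewrite card_f !card_powerset leq_exp2l // => leTQ.
  by move: leQT; rewrite (cardsD1 c0 Q) c0Q; lia.
move=> /dinjectivePn[X XT [X' /andP[/= X'X X'T] fXX']].
rewrite !powersetE in XT X'T.
have ZT : symdiff X X' \subset T.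
  by apply: subset_trans (symdiff_sub _ _) _; rewrite subUset XT.
exists (symdiff X X'); split=> //; first by rewrite symdiff_neq0 // eq_sym.
have synZ : syndrome (symdiff X X') \subset [set c0].
  apply/subsetP => c; rewrite syndrome_symdiff [_ \in symdiff _ _]in_set in_set1.
  have := congr1 (fun A : {set Vc} => c \in A) fXX'.
  by rewrite !in_setD1; case: eqVneq => //= _ ->; rewrite addbb.
have : ~~ odd #|syndrome (symdiff X X')|.
  rewrite odd_syndrome big1 // => b bZ.
  by have [_ /negbTE] := TQ b (subsetP ZT b bZ).
by move: synZ; rewrite subset1 => /orP[/eqP->|/eqP//]; rewrite cards1.
Qed.

End Syndrome.

(** * Linear inequalities forced by the minimum distance *)

Section MinimumDistance.
Variables (Vb Vc : finType) (n : nat) (S : Vb + Vc -> {set grid_node n}).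
Variable E : {set Vb * Vc}.
Hypothesis model : tanner_model S E.
Variable d : nat.
Hypothesis dist : forall X, X != set0 -> syndrome E X = set0 -> d <= #|X|.
Hypothesis d_ge4 : 3 < d.

Local Notation nb := (nbr E).
Local Notation syn := (syndrome E).

Definition bits_of_degree (k : nat) : {set Vb} := [set b | #|nb b| == k].
Definition leaf_checks : {set Vc} := \bigcup_(b in bits_of_degree 1) nb b.

Local Notation D1 := (bits_of_degree 1).
Local Notation U := leaf_checks.
Local Notation Y := (~: leaf_checks).

(** The price of [X] together with one bit of degree 1 for each violated leaf check. *)
Definition cost (X : {set Vb}) : nat := #|X| + #|syn X :&: U|.

Lemma degree_gt0 b : 0 < #|nb b|.
Proof.
rewrite lt0n; apply/negP => /eqP/cards0_eq b0.
have := @dist [set b]; rewrite syndrome1 b0 cards1 => /(_ _ erefl).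
by rewrite -cards_eq0 cards1 => /(_ isT); lia.
Qed.

(** Two bits with the same neighbours would form a codeword of weight 2. *)
Lemma nbr_inj : injective nb.
Proof.
move=> b b' bb'; apply/eqP; apply: contraT => bNb'.
have := @dist [set b; b'].
rewrite syndrome2 // bb' cards2 bNb' => h.
have : d <= 2; last lia.
apply: h; first by rewrite -cards_eq0 cards2 bNb'.
by apply/setP => c; rewrite !inE addbb.
Qed.

Lemma leaf_bit c : c \in U -> exists b, nb b = [set c].
Proof.
move=> /bigcupP[b]; rewrite inE => /cards1P[c' bc'].
by rewrite bc' in_set1 => /eqP ->; exists b.
Qed.

Lemma card_leaf_checks : #|U| = #|D1|.
Proof.
have -> : #|D1| = #|[set nb b | b in D1]| by rewrite card_imset //; exact: nbr_inj.
rewrite -(card_imset U (f := fun c => [set c])); last exact: set1_inj.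
congr #|pred_of_set _|; apply/setP => A.
apply/imsetP/imsetP => [[c cU ->]|[b bD ->]].
  have [b bc] := leaf_bit cU; exists b; rewrite ?bc //.
  by rewrite inE bc cards1.
have := bD; rewrite inE => /cards1P[c bc]; exists c => //.
by apply/bigcupP; exists b => //; rewrite bc set11.
Qed.

(* Degree-1 bits correct the part of the syndrome that lies in [U]. *)
Lemma le_cost X : X != set0 -> [disjoint X & D1] -> syn X \subset U -> d <= cost X.
Proof.
move=> X0 XD synU.
have [g gP] : exists g : Vc -> Vb, forall c, c \in syn X -> nb (g c) = [set c].
  have /set0Pn[b0 _] := X0.
  apply: (@fin_all_exists Vc (fun=> Vb)
    (fun c b => c \in syn X -> nb b = [set c])) => c.
  have [cX|cNX] := boolP (c \in syn X); last by exists b0.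
  by have [b bc] := leaf_bit (subsetP synU c cX); exists b.
pose G := [set g c | c in syn X].
have synG : syn G = syn X.
  apply/setP => c; rewrite inE.
  have [cX|cNX] := boolP (c \in syn X).
    rewrite (_ : [set b in G | _] = [set g c]) ?cards1 //.
    apply/setP => b; rewrite in_set in_set1.
    apply/andP/eqP => [[/imsetP[c' c'X ->]]|->].
      by rewrite gP // in_set1 => /eqP ->.
    by rewrite imset_f // gP // set11.
  rewrite (_ : [set b in G | _] = set0) ?cards0 //.
  apply/setP => b; rewrite in_set in_set0; apply/negP => /andP[/imsetP[c' c'X ->]].
  by rewrite gP // in_set1 => /eqP cc'; rewrite cc' c'X in cNX.
have Z0 : symdiff X G != set0.
  have /set0Pn[x xX] := X0; apply/set0Pn; exists x; rewrite inE xX.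
  apply/negP => /imsetP[c cX xg].
  by have := disjointFr XD xX; rewrite inE xg gP // cards1.
have synZ : syn (symdiff X G) = set0.
  by rewrite syndrome_symdiff synG; apply/setP => c; rewrite in_set addbb in_set0.
apply: leq_trans (dist Z0 synZ) _; apply: leq_trans (card_symdiff _ _) _.
by rewrite /cost (setIidPl synU) leq_add2l leq_imset_card.
Qed.

Lemma cost_symdiff X X' : cost (symdiff X X') <= cost X + cost X'.
Proof.
rewrite /cost syndrome_symdiff.
have -> : symdiff (syndrome E X) (syndrome E X') :&: U
    = symdiff (syndrome E X :&: U) (syndrome E X' :&: U).
  by apply/setP => c; rewrite !inE andb_addl.
have := card_symdiff X X'.
have := card_symdiff (syndrome E X :&: U) (syndrome E X' :&: U).
lia.
Qed.

Lemma cost_le X : cost X <= #|X| + \sum_(b in X) #|nb b :&: U|.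
Proof. by rewrite leq_add2l; exact: card_syndrome_le. Qed.

Lemma card_split_leaf b : #|nb b| = #|nb b :&: Y| + #|nb b :&: U|.
Proof. by rewrite addnC -(cardsID U (nb b)) setDE. Qed.

(** Two sets with the same check in [Y] would differ by a set with syndrome inside [U] and cost at
    most [2 * k], against [le_cost]. *)
Lemma singles_bound (F : {set {set Vb}}) (k : nat) : 2 * k < d ->
    (forall X, X \in F ->
       [/\ [disjoint X & D1], cost X <= k & #|syn X :&: Y| = 1]) ->
  #|F| <= #|Y|.
Proof.
move=> kd FP.
have inj : {in F &, injective (fun X => syn X :&: Y)}.
  move=> X X' XF X'F synXX'; apply/eqP; apply: contraT => XX'.
  have [dX cX _] := FP X XF; have [dX' cX' _] := FP X' X'F.
  have : d <= cost (symdiff X X'); last by have := cost_symdiff X X'; lia.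
  apply: le_cost; first exact: symdiff_neq0.
    rewrite disjoint_subset; apply/subsetP => b /(subsetP (symdiff_sub _ _)).
    by rewrite !inE => /orP[/(disjointFr dX)|/(disjointFr dX')]; rewrite inE => ->.
  apply/subsetP => c; rewrite syndrome_symdiff [_ \in symdiff _ _]in_set => cXX'.
  have := congr1 (fun A : {set Vc} => c \in A) synXX'.
  rewrite !in_setI in_setC; case: (c \in U) => //=; rewrite !andbT => e.
  by rewrite e addbb in cXX'.
rewrite -(card_in_imset inj).
have : [set syn X :&: Y | X in F] \subset [set [set c] | c in Y].
  apply/subsetP => _ /imsetP[X XF ->]; have [_ _ /eqP/cards1P[c Xc]] := FP X XF.
  apply/imsetP; exists c => //.
  by have := set11 c; rewrite -Xc in_setI => /andP[].
by move=> /subset_leq_card/leq_trans; apply; exact: leq_imset_card.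
Qed.

(** Pairs and single bits enter one family for [singles_bound]; the sizes 2 and 3 tell the bits of a
    pair apart, so no pair counts twice. *)
Lemma pairs_and_singles_bound (k : nat) (P : {set Vb * Vb}) (W : {set Vb})
    (N : Vb -> {set Vc}) :
    2 * k < d ->
    (forall q, q \in P ->
       [/\ #|N q.1| = 2, #|N q.2| = 3, 1 < #|nb q.1|, 1 < #|nb q.2|
       & cost [set q.1; q.2] <= k /\ #|syn [set q.1; q.2] :&: Y| = 1]) ->
    (forall b, b \in W ->
       [/\ 1 < #|nb b|, cost [set b] <= k & #|nb b :&: Y| = 1]) ->
  #|P| + #|W| <= #|Y|.
Proof.
move=> kd PP WP.
have pne q : q \in P -> q.1 != q.2.
  by move=> /PP[N1 N2 _ _ _]; apply/eqP => e; rewrite e N2 in N1.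
pose pr (q : Vb * Vb) := [set q.1; q.2].
have pr_inj : {in P &, injective pr}.
  move=> q q' qP q'P /setP e; have [N1 N2 _ _ _] := PP q qP.
  have [N1' N2' _ _ _] := PP q' q'P; have := e q.1; have := e q.2.
  rewrite !in_set2 !eqxx orbT /= => /esym/orP h2 /esym/orP h1.
  rewrite (surjective_pairing q) (surjective_pairing q').
  case: h1 => /eqP e1; last by rewrite e1 N2' in N1.
  case: h2 => /eqP e2; first by rewrite e2 N1' in N2.
  by rewrite e1 e2.
have -> : #|P| + #|W| = #|(pr @: P) :|: ((fun b => [set b]) @: W)|.
  rewrite cardsU (card_in_imset pr_inj) (card_imset W (@set1_inj Vb)).
  rewrite (_ : _ :&: _ = set0) ?cards0 ?subn0 //.
  apply/setP => X; rewrite !inE; apply/negP => /andP[/imsetP[q qP ->] /imsetP[b _]].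
  by move=> /(congr1 (fun A : {set Vb} => #|A|)); rewrite cards1 cards2 (pne _ qP).
apply: (singles_bound kd) => X.
rewrite inE => /orP[/imsetP[q qP ->]|/imsetP[b bW ->]].
  have [_ _ d1 d2 [c1 s1]] := PP q qP; split => //.
  rewrite disjoint_subset; apply/subsetP => b; rewrite !inE.
  by move=> /orP[]/eqP->; lia.
have [d1 c1 s1] := WP b bW; split => //; last by rewrite syndrome1.
by rewrite disjoints1 inE; lia.
Qed.

Definition singles : {set Vb} :=
  [set b | (1 < #|nb b| < 4) && (#|nb b :&: Y| == 1)].

Lemma card_symdiff_nested (A A' : {set Vc}) : A \subset A' -> #|A| = 2 ->
  #|A'| = 3 -> #|symdiff A A'| = 1.
Proof.
move=> sAA' A2 A3; have <- : #|A' :\: A| = 1 by rewrite cardsDS // A2 A3.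
congr #|pred_of_set _|; apply/setP => c; rewrite !inE.
by have := subsetP sAA' c; case: (c \in A); case: (c \in A') => // /(_ isT).
Qed.

Lemma single_cost b : b \in singles ->
  [/\ 1 < #|nb b|, cost [set b] <= 3 & #|nb b :&: Y| = 1].
Proof.
rewrite inE => /andP[/andP[b1 b4] /eqP bY]; split => //.
by rewrite /cost syndrome1 cards1; have := card_split_leaf b; lia.
Qed.

Lemma even_columns_bound (q : nat) (T : {set Vb}) (Q : {set Vc}) :
    #|Q| = q.+1 -> #|T| = q.+1 ->
    (forall b, b \in T -> nb b \subset Q /\ ~~ odd #|nb b|) -> d <= q.+1.
Proof.
move=> Qq Tq TQ.
have Q0 : Q != set0 by rewrite -card_gt0 Qq.
have QT : #|Q| <= #|T| by rewrite Qq Tq.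
have [X [XT X0 synX]] := even_columns_dependent Q0 TQ QT.
by apply: leq_trans (dist X0 synX) _; rewrite -Tq subset_leq_card.
Qed.

(** Euler's formula for the whole graph. A nested pair at a bit of degree 3 violates a single check,
    which lies in [Y], so these pairs compete with [W] for the checks of [Y]. Degrees above 4
    require [5 < d] because five even columns on five checks give a codeword of weight at most 5. *)
Lemma degree_ge2_bound (B W : {set Vb}) (k : nat) : 4 < d -> 1 < k -> 2 * k < d ->
    (forall b, b \in B -> 1 < #|nb b|) ->
    (forall b, b \in B -> 4 < #|nb b| -> 5 < d) ->
    (forall b, b \in W ->
       [/\ 1 < #|nb b|, cost [set b] <= k & #|nb b :&: Y| = 1]) ->
  2 * #|B| + #|W| <= 4 * #|Vc| + #|Y|.
Proof.
move=> d5 k2 kd B2 B5 WP.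
(* Five neighbours are kept: at most four bits of degree 2 fit inside five
   checks, and at most two inside the neighbourhood of a bit of degree 4. *)
pose N b : {set Vc} := [set c in take 5 (enum (nb b))].
have Nnb b : N b \subset nb b.
  by apply/subsetP => c; rewrite inE => /mem_take; rewrite mem_enum.
have cardN b : #|N b| = minn 5 #|nb b|.
  rewrite cardsE (card_uniqP (take_uniq 5 (enum_uniq (mem (nb b))))) size_take_min.
  by rewrite -cardE.
have N_small b : #|N b| < 5 -> N b = nb b.
  move=> Nb5; apply/eqP; rewrite eqEcard Nnb /=.
  by move: Nb5; rewrite cardN; lia.
have NE b c : b \in B -> c \in N b -> (b, c) \in E /\ c \in [set: Vc].
  by move=> _ /(subsetP (Nnb b)); rewrite !inE.
have main : 2 * #|B| <= 4 * #|[set: Vc]|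
    + #|[set q in nested_pairs B N | #|N q.2| == 3]|.
  apply: (nested_pairs_bound model NE) => [b /B2|T TB T0 T2 ev|b bB N4].
  - by rewrite cardN; lia.
  - have synT : syn T = set0.
      apply/setP => c; rewrite !inE; apply/negbTE; have := ev c.
      congr (~~ odd #|pred_of_set _|); apply/setP => b; rewrite in_set [RHS]in_set.
      by case: (boolP (b \in T)) => //= bT; rewrite N_small // T2.
    by have := dist T0 synT; lia.
  - set Pb := [set e | _].
    have PbP e : e \in Pb -> nb e \subset N b /\ #|nb e| = 2.
      rewrite !inE /= => /and5P[_ _ /eqP Ne _].
      have NeE : N e = nb e by rewrite N_small ?Ne.
      by rewrite NeE => sN; split=> //; rewrite -NeE.
    have even_Pb e : e \in Pb -> nb e \subset N b /\ ~~ odd #|nb e|.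
      by move=> /PbP[? ->].
    have [Nb4|Nb4] := eqVneq #|N b| 4.
      have Nb : N b = nb b by rewrite N_small // Nb4.
      rewrite Nb4; suff : #|Pb| < 3 by lia.
      rewrite ltnNge; apply/negP => /exists_subset_card[A APb A3].
      have bA : b \notin A.
        by apply/negP => /(subsetP APb)/PbP[_]; rewrite -Nb Nb4.
      (* The bit [b] itself is a fourth even column on its four checks. *)
      have : d <= 4; last lia.
      apply: (@even_columns_bound 3 (b |: A) (N b) Nb4).
        by rewrite cardsU1 bA A3.
      move=> e /setU1P[->|/(subsetP APb)/even_Pb //].
      by rewrite -Nb subxx Nb4.
    have Nb5 : #|N b| = 5 by move: (cardN b) Nb4 N4; lia.
    have d6 : 5 < d by apply: (B5 b bB); move: (cardN b); rewrite Nb5; lia.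
    rewrite Nb5; suff : #|Pb| < 5 by lia.
    rewrite ltnNge; apply/negP => /exists_subset_card[A APb A5].
    have : d <= 5; last lia.
    apply: (@even_columns_bound 4 A (N b) Nb5 A5) => e /(subsetP APb).
    exact: even_Pb.
rewrite cardsT in main; set P3 := [set q in _ | _] in main.
suff : #|P3| + #|W| <= #|Y| by lia.
apply: (pairs_and_singles_bound (k := k) (N := N)) => //.
move=> q; rewrite !inE => /andP[/and5P[q1 q2 /eqP N1 _ sN] /eqP N2].
have nb1 : N q.1 = nb q.1 by rewrite N_small // N1.
have nb2 : N q.2 = nb q.2 by rewrite N_small // N2.
have q12 : q.1 != q.2 by apply/eqP => e; rewrite e N2 in N1.
have syn1 : #|syn [set q.1; q.2]| = 1.
  by rewrite syndrome2 // -nb1 -nb2 card_symdiff_nested.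
have syn_split : #|syn [set q.1; q.2] :&: U| + #|syn [set q.1; q.2] :&: Y| = 1.
  by rewrite -setDE cardsID.
(* Were the violated check in [U], a bit of degree 1 would complete the pair to a codeword of weight
   at most 3. *)
have synY : #|syn [set q.1; q.2] :&: Y| != 0.
  apply/eqP => synY; have : d <= cost [set q.1; q.2].
    apply: le_cost; first by rewrite -card_gt0 cards2.
      rewrite disjoint_subset; apply/subsetP => b; rewrite !inE.
      by move=> /orP[]/eqP->; rewrite gtn_eqF // B2.
    apply/subsetP => c cX; apply: contraT => cU.
    by have := cards0_eq synY => /setP/(_ c); rewrite in_setI in_setC cX cU in_set0.
  by rewrite /cost cards2 q12; lia.
split=> //; [exact: B2|exact: B2|split; last by lia].
by rewrite /cost cards2 q12; lia.
Qed.

Definition medium_bits : {set Vb} :=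
  [set b | (1 < #|nb b| < 4) && (1 < #|nb b :&: Y|)].

(** Euler's formula for the graph induced on [Y]. A medium bit has at most one neighbour in [U], so
    a set [T] of them costs at most [2 * #|T|] if it is even on [Y]. A nested pair costs at most 3,
    since its larger bit has no neighbour in [U]. *)
Lemma medium_bits_bound : 6 < d -> 2 * #|medium_bits| + #|singles| <= 5 * #|Y|.
Proof.
move=> d7.
pose N b := nb b :&: Y.
have NE b c : b \in medium_bits -> c \in N b -> (b, c) \in E /\ c \in Y.
  by rewrite /N !inE => _ /andP[].
have main : 2 * #|medium_bits| <= 4 * #|Y|
    + #|[set q in nested_pairs medium_bits N | #|N q.2| == 3]|.
  apply: (nested_pairs_bound model NE) => [b|T TB T0 T2 ev|b bB N4].
  - by rewrite inE => /andP[].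
  - have synT : syn T \subset U.
      apply/subsetP => c; apply: contraLR => cU; rewrite inE; have := ev c.
      congr (~~ odd #|pred_of_set _|); apply/setP => b; rewrite in_set [RHS]in_set.
      by rewrite /N in_setI in_setC cU andbT.
    have TD : [disjoint T & D1].
      rewrite disjoint_subset; apply/subsetP => b /(subsetP TB).
      by rewrite !inE => /andP[/andP[b1 _] _]; lia.
    have : d <= 2 * #|T|; last by lia.
    apply: leq_trans (le_cost T0 TD synT) _; apply: leq_trans (cost_le T) _.
    rewrite mul2n -addnn leq_add2l -[X in _ <= X]muln1 -sum_nat_const.
    apply: leq_sum => b bT; have := T2 b bT; rewrite /N => Nb.
    have := subsetP TB b bT; rewrite inE => /andP[/andP[_ b4] _].
    by have := card_split_leaf b; lia.
  - move: bB; rewrite inE => /andP[/andP[_ b4] _].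
    by have := card_split_leaf b; rewrite -/(N b); lia.
set P3 := [set q in _ | _] in main.
suff : #|P3| + #|singles| <= #|Y| by lia.
apply: (pairs_and_singles_bound (k := 3) (N := N)) => //; last exact: single_cost.
move=> q; rewrite in_set => /andP[+ /eqP N2].
rewrite in_set => /and5P[q1 q2 /eqP N1 _ sN].
have q12 : q.1 != q.2 by apply/eqP => e; rewrite e N2 in N1.
move: q1 q2; rewrite !inE => /andP[/andP[a1 a4] _] /andP[/andP[b1 b4] _].
split=> //; split; last first.
  rewrite syndrome2 // -[RHS](card_symdiff_nested sN N1 N2).
  by congr #|pred_of_set _|; apply/setP => c; rewrite !inE andb_addl.
apply: leq_trans (cost_le _) _; rewrite cards2 q12 big_setU1 ?in_set1 //= big_set1.
have := card_split_leaf q.1; have := card_split_leaf q.2.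
by rewrite -/(N q.1) -/(N q.2); lia.
Qed.

(** A bit of degree at most 3 without neighbours in [Y] would have cost at most 4, against
    [le_cost]. *)
Lemma card_bits23 : 4 < d ->
  #|[set b | 1 < #|nb b| < 4]| <= #|singles| + #|medium_bits|.
Proof.
move=> d5.
have : [set b | 1 < #|nb b| < 4] \subset singles :|: medium_bits.
  apply/subsetP => b; rewrite !inE => b14; rewrite b14 /=.
  suff : 0 < #|nb b :&: Y| by case: #|_| => [|[]].
  rewrite lt0n; apply/negP => /eqP bY.
  have : d <= cost [set b]; last first.
    rewrite /cost cards1 syndrome1; have := card_split_leaf b; lia.
  apply: le_cost; first by rewrite -cards_eq0 cards1.
    by rewrite disjoints1 inE; lia.
  rewrite syndrome1; apply/subsetP => c cb; apply: contraT => cU.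
  by have := cards0_eq bY => /setP/(_ c); rewrite in_setI in_setC cb cU in_set0.
move=> /subset_leq_card/leq_trans; apply.
by rewrite cardsU leq_subr.
Qed.

Lemma degree2_bound (g : nat) (Y' : {set Vc}) : g <= d ->
    (forall b, b \in bits_of_degree 2 -> nb b \subset Y') ->
  g * #|bits_of_degree 2| <= g * #|Y'| + 2 * #|bits_of_degree 2|.
Proof.
move=> gd bY'; apply: (girth_bound model (N := nb)).
- move=> b c bD cb; split; first by move: cb; rewrite inE.
  exact: subsetP (bY' b bD) c cb.
- by move=> b; rewrite inE => /eqP.
move=> T TD T0 ev; apply: leq_trans gd _; apply: dist => //.
by apply/setP => c; rewrite !inE; apply/negbTE/ev.
Qed.

(** The girth bound with 8, on the checks that bits of degree 2 can meet: those of [Y], and at most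
    one leaf check for each single of degree 2. *)
Lemma degree2_leaf_bound : 7 < d ->
  3 * #|bits_of_degree 2| <= 4 * (#|Y| + #|singles|).
Proof.
move=> d8.
pose D2 := singles :&: bits_of_degree 2.
pose Z := \bigcup_(b in D2) (nb b :&: U).
have leZ : #|Z| <= #|singles|.
  apply: (@leq_trans (\sum_(b in D2) 1)); last first.
    by rewrite sum1_card subset_leq_card // subsetIl.
  apply: (@leq_trans (\sum_(b in D2) #|nb b :&: U|)).
    rewrite /Z; elim/big_ind2: _ => [|A a B b Aa Bb|//]; first by rewrite cards0.
    by apply: leq_trans (leq_add Aa Bb); rewrite cardsU leq_subr.
  apply: leq_sum => b; rewrite !inE => /andP[/andP[_ /eqP bY] /eqP b2].
  by have := card_split_leaf b; lia.
have := @degree2_bound 8 (Y :|: Z) d8; rewrite cardsU.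
have h b : b \in bits_of_degree 2 -> nb b \subset Y :|: Z.
  rewrite inE => /eqP b2; apply/subsetP => c cb; rewrite in_setU in_setC.
  have [cU|//] := boolP (c \in U).
  apply/bigcupP; exists b; last by rewrite in_setI cb.
  rewrite !inE b2 /= eqxx andbT.
  have split_b := card_split_leaf b.
  have bU : 0 < #|nb b :&: U| by apply/card_gt0P; exists c; rewrite in_setI cb.
  have [bY|] := eqVneq #|nb b :&: Y| 0; last by lia.
  have : d <= cost [set b]; last first.
    rewrite /cost cards1 syndrome1; lia.
  apply: le_cost; first by rewrite -cards_eq0 cards1.
    by rewrite disjoints1 inE b2.
  rewrite syndrome1; apply/subsetP => c' cb'; apply: contraT => cU'.
  by have := cards0_eq bY => /setP/(_ c'); rewrite in_setI in_setC cb' cU' in_set0.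
move=> /(_ h); lia.
Qed.

Definition bits_ge (k : nat) : {set Vb} := [set b | k <= #|nb b|].

(** In [degree_sum_bound] a degree counts as [k], plus 1 if it is larger. *)
Lemma high_degree_bound k : k * #|bits_ge k| + #|bits_ge k.+1|
  <= 2 * #|bits_ge k| + 2 * #|Vc|.
Proof.
have NE b c : b \in bits_ge k -> c \in nb b -> (b, c) \in E /\ c \in [set: Vc].
  by rewrite !inE.
have := degree_sum_bound model NE; rewrite cardsT; apply: leq_trans.
have -> : #|bits_ge k.+1| = \sum_(b in bits_ge k) (k < #|nb b|).
  rewrite -sum1_card [RHS]big_mkcond [LHS]big_mkcond; apply: eq_bigr => b _.
  by rewrite !inE; case: ltnP => [/ltnW ->|_] //; case: ifP.
rewrite mulnC -sum_nat_const -big_split; apply: leq_sum => b; rewrite inE => /=.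
by case: ltnP; lia.
Qed.

Lemma card_bits_ge k : #|bits_ge k| = #|bits_of_degree k| + #|bits_ge k.+1|.
Proof.
rewrite -(cardsID (bits_of_degree k) (bits_ge k)).
by congr (_ + _); apply: eq_card => b; rewrite !inE; lia.
Qed.

Lemma card_bits : #|Vb| = #|U| + #|bits_ge 2|.
Proof.
rewrite card_leaf_checks -card_bits_ge -cardsT; congr #|pred_of_set _|.
by apply/setP => b; rewrite !inE degree_gt0.
Qed.

Lemma card_checks : #|Vc| = #|U| + #|Y|.
Proof. by rewrite -(cardsC U). Qed.

Lemma card_checks_gt0 : 0 < #|Vb| -> 0 < #|Vc|.
Proof.
move=> /card_gt0P[b _]; have /card_gt0P[c _] := degree_gt0 b.
by apply/card_gt0P; exists c.
Qed.

Lemma degree_ge2_bound0 (B : {set Vb}) : 4 < d ->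
    (forall b, b \in B -> 1 < #|nb b|) ->
    (forall b, b \in B -> 4 < #|nb b| -> 5 < d) ->
  2 * #|B| <= 4 * #|Vc| + #|Y|.
Proof.
move=> d5 B2 B5; have := @degree_ge2_bound B set0 2 d5.
by rewrite cards0 addn0; apply=> // b; rewrite inE.
Qed.

(** The ratios are the values of [1 - R] that solve [(7 - 8 * R) / (2 * (2 * R - 1)) = d - 4] for
    [d] from 4 to 8, namely 1/8, 1/4, 5/16, 7/20 and 3/8. *)
Lemma length_bounds : 0 < #|Vb| ->
  [/\ #|Vb| < 8 * #|Vc|, 4 < d -> #|Vb| < 4 * #|Vc|,
      5 < d -> 5 * #|Vb| < 16 * #|Vc|, 6 < d -> 7 * #|Vb| < 20 * #|Vc|
    & 7 < d -> 3 * #|Vb| < 8 * #|Vc|].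
Proof.
move=> /card_checks_gt0 Vc0; have := card_bits; have := card_checks.
have := card_bits_ge 2; have := card_bits_ge 3.
have := high_degree_bound 3; have := high_degree_bound 5.
move=> h5 h3 g3 g2 cc cb.
have c23 : #|[set b | 1 < #|nb b| < 4]| = #|bits_of_degree 2| + #|bits_of_degree 3|.
  have -> : [set b | 1 < #|nb b| < 4] = bits_ge 2 :\: bits_ge 4.
    by apply/setP => b; rewrite !inE; lia.
  rewrite cardsDS; first by rewrite g2 g3; lia.
  by apply/subsetP => b; rewrite !inE; lia.
have main : 6 < d -> 2 * #|bits_ge 2| + #|singles| <= 4 * #|Vc| + #|Y|.
  move=> d7; apply: (@degree_ge2_bound _ _ 3) => //; try lia.
  - by move=> b; rewrite inE.
  - exact: single_cost.
split.
- have := @degree2_bound 4 [set: Vc] d_ge4 (fun b _ => subsetT _).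
  by rewrite cardsT; lia.
(* For [d = 5] the bits of degree at least 5 are left out here and counted by [h5]. *)
- move=> d5; have := @degree_ge2_bound0 (bits_ge 2 :\: bits_ge 5) d5.
  have -> : #|bits_ge 2 :\: bits_ge 5| = #|bits_ge 2| - #|bits_ge 5|.
    by rewrite cardsDS //; apply/subsetP => b; rewrite !inE; lia.
  have h b : b \in bits_ge 2 :\: bits_ge 5 -> 1 < #|nb b| < 5.
    by rewrite !inE -ltnNge andbC.
  move=> /(_ (fun b bB => proj1 (andP (h b bB)))).
  have h' b : b \in bits_ge 2 :\: bits_ge 5 -> 4 < #|nb b| -> 5 < d.
    by move=> /h; lia.
  by move=> /(_ h'); lia.
- move=> d6; have := @degree_ge2_bound0 (bits_ge 2) (ltnW d6).
  have h b : b \in bits_ge 2 -> 1 < #|nb b| by rewrite inE.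
  by move=> /(_ h (fun _ _ _ => d6)); lia.
(* Many singles sharpen [main], few singles sharpen the bound through the medium bits; adding the
   two eliminates their number. *)
- move=> d7; have d5 : 4 < d by lia.
  have := main d7; have := medium_bits_bound d7; have := card_bits23 d5.
  by rewrite c23; lia.
- move=> d8; have d7 : 6 < d by lia.
  have d5 : 4 < d by lia.
  have := main d7; have := medium_bits_bound d7; have := card_bits23 d5.
  have := degree2_leaf_bound d8.
  by rewrite c23; lia.
Qed.

End MinimumDistance.

Require Import Defs.
From mathcomp Require Import all_boot all_order all_algebra.
From mathcomp Require Import all_classical all_reals all_analysis.
From mathcomp Require Import lra.
Import Order.TTheory GRing.Theory Num.Theory numFieldNormedType.Exports.

(** * From plane drawings to grids *)

Section Discretization.
Local Open Scope classical_set_scope.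
Local Open Scope ring_scope.
Variable R : realType.
Implicit Types (X Y : set (R * R)) (z : R * R).

(** The distance attains a positive minimum on the compact product. *)
Lemma compact_separation X Y : compact X -> compact Y -> X `&` Y = set0 ->
  exists2 d : R, 0 < d & forall z z', X z -> Y z' ->
    `|z.1 - z'.1| < d -> `|z.2 - z'.2| < d -> False.
Proof.
move=> cX cY XY0.
have [XY|] := pselect (X `*` Y !=set0); last first.
  move=> XY; exists 1 => // z z' Xz Yz' _ _.
  by apply: XY; exists (z, z').
pose f (q : (R * R) * (R * R)) := `|q.1 - q.2|.
have cf : {within X `*` Y, continuous f}.
  apply: continuous_subspaceT => q.
  apply: (@cvg_comp _ _ _ (fun q : (R * R) * (R * R) => q.1 - q.2)); last first.
    exact: norm_continuous.
  by apply: cvgB; [exact: cvg_fst|exact: cvg_snd].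
have [c cXY cmin] := compact_EVT_min XY (compact_setX cX cY) cf.
move: cXY; rewrite inE => -[Xc Yc].
exists (f c).
  rewrite normr_gt0 subr_eq0; apply/eqP => c12.
  have : (X `&` Y) c.1 by split => //; rewrite c12.
  by rewrite XY0.
move=> z z' Xz Yz' z1 z2.
have /cmin : (z, z') \in X `*` Y by rewrite inE.
rewrite leNgt => /negP; apply.
by rewrite [X in X < _]prod_normE /= gt_max z1 z2.
Qed.

(** With tolerance 2 the integer part of a number stays near every number at distance less than
    1. *)
Definition near_int (x : R) (i : nat) : bool := `|x - i%:R| <= 2.

Lemma near_int_between x i k m :
  near_int x i -> near_int x m -> (i <= k <= m)%N -> near_int x k.
Proof.
rewrite /near_int !ler_norml => /andP[_ xi] /andP[xm _] /andP[ik km].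
have : i%:R <= k%:R :> R by rewrite ler_nat.
have : k%:R <= m%:R :> R by rewrite ler_nat.
by move=> ? ?; apply/andP; split; lra.
Qed.

Lemma floor_node (n : nat) (x : R) : 0 <= x <= n%:R ->
  exists2 i, (i <= n)%N & i%:R <= x < i%:R + 1.
Proof.
move=> /andP[x0 xn]; have /andP[tx xt] := truncn_itv x0.
exists (Num.truncn x).
  by rewrite -(ler_nat R) (le_trans tx).
by rewrite tx -natr1 in xt *; rewrite xt.
Qed.

Lemma near_int_floor x x' i :
  i%:R <= x < i%:R + 1 -> `|x - x'| < 1 -> near_int x' i.
Proof.
rewrite /near_int ltr_norml ler_norml => /andP[? ?] /andP[? ?].
by apply/andP; split; lra.
Qed.

Section Near.
Variables (L H : R) (n : nat).

Definition near_node z (v : grid_node n) : bool :=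
  near_int (L * z.1 + H) v.1 && near_int (L * z.2 + H) v.2.

Lemma near_node_nat z i j : (i <= n)%N -> (j <= n)%N ->
  near_node z (node n i j)
  = near_int (L * z.1 + H) i && near_int (L * z.2 + H) j.
Proof. by move=> ? ?; rewrite /near_node /= !inordK. Qed.

Definition nodes_near X : {set grid_node n} :=
  [set v | `[< exists2 z, X z & near_node z v >]]%SET.

Lemma nodes_nearP X v :
  reflect (exists2 z, X z & near_node z v) (v \in nodes_near X).
Proof. by rewrite inE; exact: asboolP. Qed.

(** The nodes near one point fill a box, which is crossed first horizontally and then vertically. *)
Lemma near_box z (P : {set grid_node n}) :
  (forall e, near_node z (grid_src e) -> near_node z (grid_tgt e) ->
     (grid_src e \in P) = (grid_tgt e \in P)) ->
  forall v w, near_node z v -> near_node z w -> (v \in P) = (w \in P).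
Proof.
move=> eP.
have horiz i k j : (i + k <= n)%N -> (j <= n)%N ->
    near_node z (node n i j) -> near_node z (node n (i + k) j) ->
    (node n i j \in P) = (node n (i + k) j \in P).
  elim: k => [|k IHk] ik jn; first by rewrite addn0.
  have ikn : (i + k < n)%N by lia.
  rewrite !near_node_nat //; last lia.
  move=> /andP[zi zj] /andP[zik _].
  have zik' : near_int (L * z.1 + H) (i + k)%N.
    by apply: near_int_between zi zik _; lia.
  rewrite IHk ?near_node_nat ?zi ?zik' ?zj //; try lia.
  have := eP (inl (Ordinal ikn, Ordinal (jn : (j < n.+1)%N))).
  rewrite addnS /= !near_node_nat //; last lia.
  by rewrite zik' zj -addnS zik; apply.
have vert i j k : (i <= n)%N -> (j + k <= n)%N ->
    near_node z (node n i j) -> near_node z (node n i (j + k)) ->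
    (node n i j \in P) = (node n i (j + k) \in P).
  move=> inn; elim: k => [|k IHk] jk; first by rewrite addn0.
  have jkn : (j + k < n)%N by lia.
  rewrite !near_node_nat //; last lia.
  move=> /andP[zi zj] /andP[_ zjk].
  have zjk' : near_int (L * z.2 + H) (j + k)%N.
    by apply: near_int_between zj zjk _; lia.
  rewrite IHk ?near_node_nat ?zi ?zjk' ?zj //; try lia.
  have := eP (inr (Ordinal (inn : (i < n.+1)%N), Ordinal jkn)).
  rewrite addnS /= !near_node_nat //; last lia.
  by rewrite zjk' zi -addnS zjk; apply.
move=> [v1 v2] [w1 w2]; rewrite -(nodeK (v1, v2)) -(nodeK (w1, w2)) /=.
have [lv1 lv2 lw1 lw2] := And4 (ltn_ord v1) (ltn_ord v2) (ltn_ord w1) (ltn_ord w2).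
move: lv1 lv2 lw1 lw2; move: (v1 : nat) (v2 : nat) (w1 : nat) (w2 : nat).
move=> {v1 v2 w1 w2} i j i' j'; rewrite !ltnS => ln1 ln2 ln3 ln4.
rewrite !near_node_nat // => /andP[zi zj] /andP[zi' zj'].
apply: (@etrans _ _ (node n i' j \in P)).
  have [ii'|/ltnW ii'] := leqP i i'.
    by rewrite -(subnKC ii'); apply: horiz;
      rewrite ?subnKC ?near_node_nat ?zi ?zi' ?zj.
  by rewrite -(subnKC ii'); apply/esym/horiz;
      rewrite ?subnKC ?near_node_nat ?zi ?zi' ?zj.
have [jj'|/ltnW jj'] := leqP j j'.
  by rewrite -(subnKC jj'); apply: vert;
      rewrite ?subnKC ?near_node_nat ?zj ?zi' ?zj'.
by rewrite -(subnKC jj'); apply/esym/vert;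
      rewrite ?subnKC ?near_node_nat ?zj ?zi' ?zj'.
Qed.

(** Points of [X] closer than [1 / L] share a near node. The points with a near node in [P]
    therefore form an open and closed part of [X]. *)
Lemma nodes_near_connected X : 0 < L ->
  (forall z, X z -> 0 <= L * z.1 + H <= n%:R /\ 0 <= L * z.2 + H <= n%:R) ->
  connected X -> node_connected (nodes_near X).
Proof.
move=> L0 Xn cX P eP.
have box z v w : X z -> near_node z v -> near_node z w -> (v \in P) = (w \in P).
  move=> Xz; apply: near_box => e zs zt.
  by apply: eP; apply/nodes_nearP; exists z.
pose B := [set z | X z /\ exists2 v, near_node z v & v \in P].
have local z z' : X z -> X z' -> ball z L^-1 z' -> B z <-> B z'.
  move=> Xz Xz' [/= b1 b2].
  have [/floor_node[i lin iz] /floor_node[j ljn jz]] := Xn _ Xz.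
  have close x x' : ball x L^-1 x' -> `|L * x + H - (L * x' + H)| < 1.
    rewrite -ball_normE /= => b.
    rewrite opprD addrACA subrr addr0 -mulrBr normrM gtr0_norm //.
    by rewrite mulrC -ltr_pdivlMr // mul1r.
  have close0 x : `|L * x + H - (L * x + H)| < 1 by rewrite subrr normr0.
  have zv : near_node z (node n i j).
    by rewrite near_node_nat // (near_int_floor iz) ?(near_int_floor jz).
  have z'v : near_node z' (node n i j).
    by rewrite near_node_nat // (near_int_floor iz) ?(near_int_floor jz) ?close.
  split=> -[_ [v zv' vP]]; split => //; exists (node n i j) => //.
    by rewrite (box z _ v).
  by rewrite (box z' _ v).
pose nbh (C : set (R * R)) := \bigcup_(z in C) (ball z L^-1)^°.
have onbh C : open (nbh C) by apply: bigcup_open => z _; exact: open_interior.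
have self z : (ball z L^-1)^° z by apply: nbhsx_ballx; rewrite invr_gt0.
move=> v w /nodes_nearP[z Xz zv] /nodes_nearP[z' Xz' z'w] vP.
have BX : B = X.
  apply: cX; first by exists z; split => //; exists v.
    exists (nbh B) => //; apply/seteqP; split => y.
      by move=> By; split; [case: By|exists y].
    move=> [Xy [y' By' /interior_subset y'y]].
    exact: (local y' y By'.1 Xy y'y).1 By'.
  exists (~` nbh (X `\` B)); first exact/open_closedC.
  apply/seteqP; split => y.
    move=> By; split; first by case: By.
    move=> [y' [Xy' NBy'] /interior_subset y'y]; apply: NBy'.
    exact: (local y' y Xy' By.1 y'y).2 By.
  move=> [Xy Ny]; apply: contrapT => NBy; apply: Ny.
  by exists y.
have : B z' by rewrite BX.
by move=> [_ [w' z'w' w'P]]; rewrite (box z' _ w').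
Qed.

End Near.
End Discretization.

(** * Branch sets of the Tanner graph in a fine grid *)

Section TannerGridModel.
Local Open Scope classical_set_scope.
Local Open Scope ring_scope.
Variable R : realType.

(** Points near a common node differ by at most [4 / L] in each coordinate, and [L] is chosen so
    large that this is below the separation of any two disjoint sets. The shift [H] makes all
    coordinates nonnegative. *)
Lemma fine_grid (I : finType) (K : I -> set (R * R)) :
  (forall i, compact (K i)) -> exists (L H : R) (n : nat),
  [/\ 0 < L,
      forall i z, K i z -> 0 <= L * z.1 + H <= n%:R /\ 0 <= L * z.2 + H <= n%:R
    & forall i i' z z' v, K i z -> K i' z' ->
        near_node L H (n := n) z v -> near_node L H z' v -> K i `&` K i' !=set0].
Proof.
move=> cK.
have [d dP] : exists d : I * I -> R, forall q, 0 < d q /\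
    (K q.1 `&` K q.2 = set0 -> forall z z', K q.1 z -> K q.2 z' ->
      `|z.1 - z'.1| < d q -> `|z.2 - z'.2| < d q -> False).
  apply: (@fin_all_exists _ (fun=> R) (fun q d => 0 < d /\ (_ -> forall z z',
    K q.1 z -> K q.2 z' -> `|z.1 - z'.1| < d -> `|z.2 - z'.2| < d -> False))).
  move=> q; have [q0|q0] := pselect (K q.1 `&` K q.2 = set0); last by exists 1.
  by have [e e0 eP] := compact_separation (cK q.1) (cK q.2) q0; exists e.
have [k kP] : exists k : I -> R, forall i, 0 < k i /\ forall z, K i z -> `|z| < k i.
  apply: (@fin_all_exists _ (fun=> R)
    (fun i k => 0 < k /\ forall z, K i z -> `|z| < k)).
  move=> i; have /ex_strict_bound_gt0[k k0 kK] := compact_bounded (cK i).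
  by exists k.
pose L := 1 + \sum_q 4 / d q; pose M := \sum_i k i.
have L_gt q : 4 / d q < L.
  rewrite /L (bigD1 q) //= addrCA ltrDl.
  apply: ltr_pwDl => //; apply: sumr_ge0 => q' _; apply: divr_ge0 => //.
  by case: (dP q') => /ltW.
have L0 : 0 < L.
  rewrite ltr_pwDl // sumr_ge0 // => q' _; apply: divr_ge0 => //.
  by case: (dP q') => /ltW.
have M_ge i z : K i z -> `|z.1| <= M /\ `|z.2| <= M.
  move=> /(kP i).2; rewrite prod_normE gt_max => /andP[/ltW z1 /ltW z2].
  have kM : k i <= M.
    rewrite /M (bigD1 i) //= lerDl.
    by apply: sumr_ge0 => i' _; case: (kP i') => /ltW.
  by split; [apply: le_trans z1 _|apply: le_trans z2 _].
pose H := L * M; pose n := (Num.truncn (H + H)).+1.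
exists L, H, n; split => // [i z /M_ge[z1 z2]|i i' z z' v Kz Kz'].
  have bnd x : `|x| <= M -> 0 <= L * x + H <= n%:R.
    rewrite ler_norml => /andP[xl xu].
    have x0 : 0 <= L * x + H by rewrite /H -mulrDr mulr_ge0 ?(ltW L0) //; lra.
    rewrite x0 /= (@le_trans _ _ (H + H)) //.
      by rewrite lerD2r /H ler_pM2l.
    have H0 : 0 <= H + H.
      by rewrite (le_trans x0) // lerD2r /H ler_pM2l.
    by have /andP[_ /ltW] := truncn_itv H0.
  by split; exact: bnd.
move=> /andP[v1 v2] /andP[v1' v2'].
have close x x' m : near_int (L * x + H) m -> near_int (L * x' + H) m ->
    `|x - x'| < d (i, i').
  rewrite /near_int !ler_norml => /andP[a1 a2] /andP[a3 a4].
  have [d0 _] := dP (i, i'); have := L_gt (i, i').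
  rewrite ltr_pdivrMr // => Ld.
  rewrite -(ltr_pM2l L0) -{1}(gtr0_norm L0) -normrM (le_lt_trans _ Ld) //.
  by rewrite ler_norml mulrBr; apply/andP; split; lra.
apply: contrapT => /set0P/negP/negPn/eqP e0.
by apply: ((dP (i, i')).2 e0 z z' Kz Kz'); apply: close; eassumption.
Qed.

Variables (Vb Vc : finType) (E : {set Vb * Vc}).

(** An edge of a drawing is an unordered pair, so its arc may run either way; reversal where [rv]
    fails makes every arc run from bit to check. *)
Lemma tanner_arcs : planar R (tanner_rel E) ->
  exists (p : Vb + Vc -> R * R) (h : Vb * Vc -> R -> R * R),
  [/\ injective p,
      forall q, q \in E -> [/\ {within `[0, 1], continuous (h q)},
        h q 0 = p (inl q.1) & h q 1 = p (inr q.2)],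
      forall q t v, q \in E -> 0 <= t <= 1 -> h q t = p v ->
        (t = 0 /\ v = inl q.1) \/ (t = 1 /\ v = inr q.2)
    & forall q q' t t', q \in E -> q' \in E -> q != q' ->
        0 <= t <= 1 -> 0 <= t' <= 1 -> h q t = h q' t' -> exists v, h q t = p v].
Proof.
move=> [p [g [p_inj arcs inner disj]]].
pose A (q : Vb * Vc) : {set Vb + Vc} := [set inl q.1; inr q.2]%SET.
have AE q : q \in E -> A q \in edge_set (tanner_rel E).
  move=> qE; apply/imset2P; exists (inl q.1) (inr q.2) => //.
  by rewrite inE /=; case: q qE.
have A_inj q q' : A q = A q' -> q = q'.
  move=> Aqq'; rewrite (surjective_pairing q) (surjective_pairing q').
  have : inl q.1 \in A q' by rewrite -Aqq' !inE eqxx.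
  rewrite !inE => /orP[/eqP[->]|/eqP//].
  have : inr q.2 \in A q' by rewrite -Aqq' !inE eqxx orbT.
  by rewrite !inE => /orP[/eqP//|/eqP[->]].
pose rv (q : Vb * Vc) : bool := `[< g (A q) 0 = p (inl q.1) >].
have in0 : (0 : R) \in `[0, 1] by rewrite in_itv /= lexx ler01.
have in1 : (1 : R) \in `[0, 1] by rewrite in_itv /= lexx ler01.
pose h q t := g (A q) (if rv q then t else 1 - t).
have h01 q : q \in E -> h q 0 = p (inl q.1) /\ h q 1 = p (inr q.2).
  move=> /AE/arcs[[_ ginj] ends].
  have g01 : g (A q) 0 <> g (A q) 1.
    move=> g01; have /eqP := ginj 0 1 in0 in1 g01.
    by rewrite eq_sym oner_eq0.
  have : [set g (A q) 0; g (A q) 1] (p (inl q.1)).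
    by rewrite ends; exists (inl q.1) => //=; rewrite !inE eqxx.
  have : [set g (A q) 0; g (A q) 1] (p (inr q.2)).
    by rewrite ends; exists (inr q.2) => //=; rewrite !inE eqxx orbT.
  have pne : p (inl q.1) <> p (inr q.2) by move=> /p_inj.
  rewrite /h /rv => -[c0|c1] [b0|b1].
  - by case: pne; rewrite b0 c0.
  - by case: asboolP => [g0|_]; [case: g01; rewrite -b1 g0|rewrite subr0 subrr].
  - by case: asboolP => [_|[]].
  - by case: pne; rewrite b1 c1.
have h_inner q t : 0 < t < 1 -> (g (A q) @` `]0, 1[) (h q t).
  move=> t01; exists (if rv q then t else 1 - t) => //=.
  by case: ifP => _; rewrite in_itv /=; move: t01; lra.
have cases (t : R) : 0 <= t <= 1 -> [\/ 0 < t < 1, t = 0 | t = 1].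
  rewrite !le_eqVlt => /andP[/orP[/eqP<-|t0] /orP[/eqP ->|t1]].
  - by apply: Or32.
  - by apply: Or32.
  - by apply: Or33.
  - by apply: Or31; rewrite t0.
exists p, h; split => //.
- move=> q qE; have [h0 h1] := h01 _ qE; split=> //.
  have [[gc _] _] := arcs _ (AE _ qE).
  rewrite /h; case: (rv q) => //.
  move: gc => /subspace_continuousP gc; apply/subspace_continuousP => x x01.
  have flip (t : R) : `[0, 1]%classic t -> `[0, 1]%classic (1 - t).
    by rewrite /= !in_itv /=; lra.
  apply: (@cvg_comp _ _ _ (fun t : R => 1 - t)); last exact: (gc _ (flip _ x01)).
  move=> U nU; change (nbhs x [set t | `[0, 1]%classic t -> U (1 - t)]).
  have : (fun t : R => 1 - t) @ x --> 1 - x.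
    by apply: cvgB; [exact: cvg_cst|exact: cvg_id].
  move=> /(_ _ nU) nU'; apply: (@filterS _ (nbhs x) _ _ _ _ nU').
  by move=> t /= tU /flip/tU.
- move=> q t v qE /cases[t01|->|->] htv.
  + case: (inner _ v (AE _ qE)); rewrite -htv; exact: h_inner.
  + by left; split => //; apply: p_inj; rewrite -htv; case: (h01 _ qE).
  + by right; split => //; apply: p_inj; rewrite -htv; case: (h01 _ qE).
- move=> q q' t t' qE q'E qq' /cases[t01|->|->]; last 2 first.
  + by exists (inl q.1); case: (h01 _ qE).
  + by exists (inr q.2); case: (h01 _ qE).
  move=> /cases[t'01|->|->] htt'; last 2 first.
  + by exists (inl q'.1); rewrite htt'; case: (h01 _ q'E).
  + by exists (inr q'.2); rewrite htt'; case: (h01 _ q'E).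
  have AA : A q <> A q' by move=> /A_inj/eqP; apply/negP.
  have : ((g (A q) @` `]0, 1[) `&` (g (A q') @` `]0, 1[)) (h q t).
    by split; [exact: h_inner|rewrite htt'; exact: h_inner].
  by rewrite disj //; exact: AE.
Qed.

Lemma segment_piece_compact (f : R -> R * R) (a b : R) : 0 <= a -> b <= 1 ->
  {within `[0, 1], continuous f} -> compact (f @` `[a, b]).
Proof.
move=> a0 b1 cf; apply: continuous_compact; last exact: segment_compact.
by apply: continuous_subspaceW cf => t /=; rewrite !in_itv /=; lra.
Qed.

(** Each arc is cut at 2/3 into a piece owned by its bit and a piece owned by its check. In a fine
    grid, pieces that share a near node have the same owner or lie on the same arc. *)
Lemma tanner_grid_model : planar R (tanner_rel E) ->
  exists (n : nat) (S : Vb + Vc -> {set grid_node n}), tanner_model S E.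
Proof.
move=> /tanner_arcs[p [h [p_inj hE h_vertex h_cross]]].
pose I := (Vb + Vc + Vb * Vc * bool)%type.
pose K (i : I) : set (R * R) := match i with
  | inl v => [set p v]
  | inr (q, x) => if q \in E then
      (if x then h q @` `[2 / 3, 1] else h q @` `[0, 2 / 3]) else set0 end.
pose own (i : I) : Vb + Vc := match i with
  | inl v => v | inr (q, x) => if x then inr q.2 else inl q.1 end.
have cK i : compact (K i).
  case: i => [v|[q x]] /=; first exact: compact_set1.
  case: ifPn => [/hE[cq _ _]|_]; last exact: compact0.
  by case: x; apply: segment_piece_compact => //; lra.
have K_param q x z : K (inr (q, x)) z -> q \in E /\
    exists2 t, 0 <= t <= 1 & h q t = z /\ (if x then t <> 0 else t <> 1).
  rewrite /=; case: ifPn => // qE; case: x => -[t /=]; rewrite in_itv /= => t01 <-.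
    by split=> //; exists t; [lra|split => // t0; lra].
  by split=> //; exists t; [lra|split => // t0; lra].
have K_own i v : K i (p v) -> own i = v.
  case: i => [w /= /p_inj //|[q x]] /K_param[qE [t t01 [/h_vertex ht tx]]].
  by case: (ht qE t01) => -[t' ->]; move: tx; rewrite t' /=; case: (x).
have K_meet i i' : K i `&` K i' !=set0 ->
    own i = own i' \/ exists q x x', i = inr (q, x) /\ i' = inr (q, x').
  move=> [z [iz i'z]]; case: (pselect (exists v, z = p v)) => [[v zv]|Nz].
    by left; rewrite (K_own i v) ?(K_own i' v) -?zv.
  case: i iz => [w /= zw|[q x] /K_param[qE [t t01 [ht _]]]].
    by case: Nz; exists w.
  case: i' i'z => [w /= zw|[q' x'] /K_param[q'E [t' t'01 [ht' _]]]].
    by case: Nz; exists w.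
  have [->|qq'] := eqVneq q q'; first by right; exists q', x, x'.
  case: Nz; have [|v hv] := h_cross q q' t t' qE q'E qq' t01 t'01.
    by rewrite ht ht'.
  by exists v; rewrite -ht.
have [L [H [n [L0 Kn Kmeet]]]] := fine_grid cK.
have {Kmeet} K_near i i' z z' v : K i z -> K i' z' ->
    near_node L H (n := n) z v -> near_node L H z' v ->
    own i = own i' \/ exists q x x', i = inr (q, x) /\ i' = inr (q, x').
  by move=> iz i'z' zv z'v; apply: K_meet; exact: Kmeet iz i'z' zv z'v.
have near_ex i z : K i z -> exists v, near_node L H (n := n) z v.
  move=> /Kn[/floor_node[a an az] /floor_node[b bn bz]].
  exists (node n a b); rewrite near_node_nat //.
  by rewrite (near_int_floor az) ?(near_int_floor bz) // subrr normr0.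
have K_self i z : K i z -> K i (p (own i)).
  case: i => [//|[q x]] /=; case: ifPn => // /hE[_ h0 h1]; case: x => _ /=.
    by exists 1 => //=; rewrite in_itv /=; lra.
  by exists 0 => //=; rewrite in_itv /=; lra.
(* A check owns the nodes near the last thirds of its arcs; a bit owns the nodes
   that can be reached from it along its arcs without entering those zones. *)
pose star v := \bigcup_(i in [set i | own i = v /\ K i (p v)]) K i.
have star_piece i z : K i z -> star (own i) z.
  by move=> iz; exists i => //; split=> //; exact: K_self iz.
have K_conn i : connected (K i).
  case: i => [v|[q x]] /=; first exact: connected1.
  case: ifPn => [/hE[cq _ _]|_]; last exact: connected0.
  by case: x; apply: connected_continuous_connected => //;
    try exact: segment_connected;
    apply: continuous_subspaceW cq => t /=; rewrite !in_itv /=; lra.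
pose C c : {set grid_node n} := nodes_near L H n (star (inr c)).
pose Z b := star (inl b) `|`
  \bigcup_(i in [set i : I | exists c, i = inr (b, c, true)]) K i.
pose Q b : {set grid_node n} :=
  [set x | (x \in nodes_near L H n (Z b)) && [forall c, x \notin C c]]%SET.
have nearP (X : set (R * R)) v :
    v \in nodes_near L H n X <-> exists2 z, X z & near_node L H z v.
  by split => [/nodes_nearP|?]; [|exact/nodes_nearP].
have [v0 v0P] : exists v0 : Vb + Vc -> grid_node n,
    forall u, near_node L H (p u) (v0 u).
  apply: (@fin_all_exists _ (fun=> grid_node n)
    (fun u v => near_node L H (p u) v)) => u.
  exact: (near_ex (inl u)).
have v0Q b : v0 (inl b) \in Q b.
  rewrite inE; apply/andP; split.
    apply/nearP; exists (p (inl b)) => //.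
    by left; exact: (star_piece (inl (inl b)) _ erefl).
  apply/forallP => c; apply/negP => /nearP[z [i [ic _] iz] zv].
  have [|[q [x [x' []]]]] :=
    K_near (inl (inl b)) i (p (inl b)) z _ erefl iz (v0P _) zv => //.
  by rewrite ic.
pose KQ b :=
  [set e : grid_edge n | (grid_src e \in Q b) && (grid_tgt e \in Q b)]%SET.
pose con b := connect (edge_adj (@grid_src n) (@grid_tgt n) (KQ b)).
pose SB b := [set y | con b (v0 (inl b)) y]%SET.
have SBQ b x : x \in SB b -> x \in Q b.
  have KQ_Q e : e \in KQ b -> (grid_src e \in Q b) = (grid_tgt e \in Q b).
    by rewrite inE => /andP[-> ->].
  by rewrite inE => /(connect_invariant KQ_Q) <-; exact: v0Q.
have Cown c v : v \in C c ->
    exists i z, [/\ own i = inr c, K i z & near_node L H z v].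
  by move=> /nearP[z [i [ic _] iz] zv]; exists i, z.
(* A node near the last third of an arc lies in some [C c] and so is outside [Q b]. *)
have Qown b v : v \in Q b ->
    exists i z, [/\ own i = inl b, K i z & near_node L H z v].
  rewrite inE => /andP[/nearP[z [[i [ib _] iz]|[i [c ic] iz]] zv] /forallP NC].
    by exists i, z.
  have /negP[] := NC c; apply/nearP; exists z => //.
  by have := star_piece _ _ iz; rewrite ic.
have CC c c' v : v \in C c -> v \in C c' -> c = c'.
  move=> /Cown[i [z [ic iz zv]]] /Cown[i' [z' [ic' iz' zv']]].
  have [|[q [x [x' [iq iq']]]]] := K_near i i' z z' v iz iz' zv zv'.
    by rewrite ic ic' => -[].
  by move: ic ic'; rewrite iq iq' /=; case: (x) (x') => -[] // [<-] [<-].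
have QQ b b' v : v \in Q b -> v \in Q b' -> b = b'.
  move=> /Qown[i [z [ic iz zv]]] /Qown[i' [z' [ic' iz' zv']]].
  have [|[q [x [x' [iq iq']]]]] := K_near i i' z z' v iz iz' zv zv'.
    by rewrite ic ic' => -[].
  by move: ic ic'; rewrite iq iq' /=; case: (x) (x') => -[] // [<-] [<-].
have QC b c v : v \in Q b -> v \in C c -> False.
  by rewrite inE => /andP[_ /forallP/(_ c)/negP].
pose S v := match v with inl b => SB b | inr c => C c end.
exists n, S; split.
- case=> [b|c]; apply/set0Pn.
    by exists (v0 (inl b)); rewrite inE; exact: connect0.
  exists (v0 (inr c)); apply/nearP; exists (p (inr c)) => //.
  exact: (star_piece (inl (inr c)) _ erefl).
- case=> [b|c] [b'|c'] x //=.
  + by move=> /SBQ xb /SBQ xb'; rewrite (QQ _ _ _ xb xb').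
  + by move=> /SBQ xb /(QC _ _ _ xb).
  + by move=> xc /SBQ /QC/(_ xc).
  + by move=> xc xc'; rewrite (CC _ _ _ xc xc').
- case=> [b|c] /=.
    move=> P eP v w vS wS vP.
    have PSK e : e \in KQ b ->
        (grid_src e \in (P :&: SB b)%SET) = (grid_tgt e \in (P :&: SB b)%SET).
      move=> /(component_invariant (@grid_src n) (@grid_tgt n) (v0 (inl b))) st.
      rewrite !finset.in_setI; have := eP e; rewrite ![_ \in SB b]inE /con st.
      by case: (connect _ _ _) => [->//|_]; rewrite !andbF.
    have vw : con b v w.
      apply: (@connect_trans _ _ (v0 (inl b))); last by move: wS; rewrite inE.
      by rewrite edge_adj_sym; move: vS; rewrite inE.
    have := connect_invariant PSK vw.
    by rewrite !finset.in_setI vP vS wS /= andbT => <-.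
  (* The pieces forming the star of [c] are connected and share the point [p (inr c)]. *)
  apply: nodes_near_connected => //.
    by move=> z [i _ /Kn].
  apply: bigcup_connected; last by move=> i _; exact: K_conn.
  by exists (p (inr c)) => i [].
(* The nodes near the arc are connected and lead from [SB b] to [C c]. An edge among them that
   leaves [SB b] ends in some [C c'], and [SAC] gives [c' = c]. *)
- move=> [b c] qE /=; apply: contrapT => no_edge.
  have [ch h0 h1] := hE _ qE.
  pose arc := h (b, c) @` `[0, 1].
  pose SA := nodes_near L H n arc.
  have arcK z : arc z -> K (inr ((b, c), false)) z \/ K (inr ((b, c), true)) z.
    move=> [t /=]; rewrite in_itv /= qE => t01 <-.
    have [t23|t23] := lerP t (2 / 3); [left|right];
      by exists t => //=; rewrite in_itv /=; lra.
  have arcZ z : arc z -> Z b z.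
    move=> /arcK[K0|K1]; first by left; exact: (star_piece _ _ K0).
    by right; exists (inr ((b, c), true)) => //; exists c.
  have SAC v c' : v \in SA -> v \in C c' -> c' = c.
    move=> /nearP[z az zv] /Cown[i' [z' [ic' iz' zv']]].
    have [x Kx] : exists x, K (inr ((b, c), x)) z.
      by case: (arcK z az); [exists false|exists true].
    have [|[q [x1 [x2 [[<- _] iq']]]]] := K_near _ i' z z' v Kx iz' zv zv'.
      by rewrite ic' /=; case: (x) => -[].
    by move: ic'; rewrite iq' /=; case: (x2) => -[].
  have SA_conn : node_connected SA.
    apply: nodes_near_connected => //.
      by move=> z /arcK[] /Kn.
    by apply: connected_continuous_connected => //; exact: segment_connected.
  have step x y : y \in SA -> x \in SB b -> y \notin SB b ->
      edge_adj (@grid_src n) (@grid_tgt n) [set: grid_edge n]%SET x y -> y \in C c.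
    move=> ySA xS yNS /existsP[e /andP[_ exy]].
    have yNQ : y \notin Q b.
      apply: contra yNS => yQ; move: (xS); rewrite !inE => cx.
      apply: (connect_trans cx); apply: connect1; apply/existsP; exists e.
      rewrite exy andbT inE.
      by case/orP: exy => /andP[/eqP-> /eqP->]; rewrite yQ (SBQ _ _ xS).
    move: yNQ; rewrite inE negb_and => /orP[/negP[]|].
      by move: ySA => /nearP[z /arcZ Zz zy]; apply/nearP; exists z.
    rewrite negb_forall => /existsP[c']; rewrite negbK => yC.
    by rewrite -(SAC _ _ ySA yC).
  have SBSA e : grid_src e \in SA -> grid_tgt e \in SA ->
      (grid_src e \in SB b) = (grid_tgt e \in SB b).
    move=> sSA tSA.
    apply/idP/idP => eS; apply: contraT => eNS; case: no_edge; exists e.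
      apply/orP; left; rewrite eS /=; apply: step eS eNS _ => //.
      by apply/existsP; exists e; rewrite inE !eqxx.
    apply/orP; right; rewrite eS andbT /=; apply: step eS eNS _ => //.
    by apply/existsP; exists e; rewrite inE !eqxx orbT.
  have v0SA : v0 (inl b) \in SA.
    apply/nearP; exists (p (inl b)) => //.
    by exists 0 => //=; rewrite in_itv /= lexx ler01.
  have w0SA : v0 (inr c) \in SA.
    apply/nearP; exists (p (inr c)) => //.
    by exists 1 => //=; rewrite in_itv /= lexx ler01.
  have v0S : v0 (inl b) \in SB b by rewrite inE; exact: connect0.
  have := SA_conn _ SBSA _ _ v0SA w0SA v0S => /SBQ/(QC _ c); apply.
  apply/nearP; exists (p (inr c)) => //.
  exact: (star_piece (inl (inr c)) _ erefl).
Qed.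
End TannerGridModel.

(** * The bound on the minimum distance *)

Section TannerCode.
Local Open Scope ring_scope.
Variables (Vb Vc : finType) (E : {set Vb * Vc}).

Definition set_word (X : {set Vb}) : {ffun Vb -> 'F_2} :=
  [ffun b => if b \in X then 1 else 0].

Lemma weight_set_word X : weight (set_word X) = #|X|.
Proof.
by apply: eq_card => b; rewrite inE ffunE; case: ifP; rewrite ?oner_eq0 ?eqxx.
Qed.

Lemma natr_F2_even k : ~~ odd k -> k%:R = 0 :> 'F_2.
Proof.
move=> /negbTE k_even; rewrite -(odd_double_half k) k_even add0n -muln2 natrM.
by rewrite (_ : 2%:R = 0) ?mulr0 //; apply: val_inj.
Qed.

Lemma set_word_code X : syndrome E X = finset.set0 -> set_word X \in tanner_code E.
Proof.
move=> /setP synX; rewrite inE; apply/forallP => c.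
have := synX c; rewrite !inE => /negbT even_c.
rewrite (eq_bigr (fun b => if b \in X then 1 else 0)); last first.
  by move=> b _; rewrite ffunE.
rewrite -big_mkcondr sumr_const -(natr_F2_even even_c); apply/eqP.
by congr (_ *+ _); apply: eq_card => b; rewrite !inE andbC.
Qed.

Lemma min_distance_set_bound d : is_min_distance E d ->
  forall X, X != finset.set0 -> syndrome E X = finset.set0 -> (d <= #|X|)%N.
Proof.
move=> [_ dmin] X /set0Pn[b bX] synX; rewrite -weight_set_word.
apply: dmin; first exact: set_word_code.
by apply/eqP => /ffunP/(_ b)/eqP; rewrite !ffunE bX oner_eq0.
Qed.

End TannerCode.

Local Open Scope ring_scope.

Theorem theorem5 (R : realType) (Vb Vc : finType) (E : {set Vb * Vc})
    (d : nat) :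
  planar R (tanner_rel E) ->
  5 / 8 <= rate R Vb Vc ->
  is_min_distance E d ->
  d%:Z <= Num.ceil ((7 - 8 * rate R Vb Vc) / (2 * (2 * rate R Vb Vc - 1))) + 3.
Proof.
move=> /tanner_grid_model[n [S model]] rate_ge dmin.
have Vb0 : (0 < #|Vb|)%N.
  have [[x [_ x0 _]] _] := dmin.
  rewrite lt0n; apply: contraNneq x0 => /card0_eq Vb0.
  by apply/eqP/ffunP => b; have := Vb0 b; rewrite inE.
have nR : 0 < #|Vb|%:R :> R by rewrite ltr0n.
have mE : #|Vc|%:R = (1 - rate R Vb Vc) * #|Vb|%:R.
  by rewrite /rate opprB addrCA subrr addr0 divfK // gt_eqF.
set r := rate R Vb Vc in rate_ge mE *.
have short : (8 * #|Vc| <= 3 * #|Vb|)%N.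
  by rewrite -(ler_nat R) !natrM mE mulrA ler_pM2r //; lra.
(* A strict inequality for [d - 4] passes to the ceiling and gains the missing 1 for integers. *)
suff lt_ratio : (d%:Z - 4)%:~R < (7 - 8 * r) / (2 * (2 * r - 1)).
  have : d%:Z - 4 < Num.ceil ((7 - 8 * r) / (2 * (2 * r - 1))).
    by rewrite -(ltr_int R) (lt_le_trans lt_ratio) // ceil_ge.
  by lia.
have den0 : 0 < 2 * (2 * r - 1) by lra.
rewrite ltr_pdivlMr // -(ltr_pM2r nR).
(* For [d <= 3] the left side is at most -1, and [r <= 1] suffices. *)
have [d_le3|d_ge4] := leqP d 3.
  have : (d%:Z - 4)%:~R <= -1 :> R.
    by rewrite -[-1]/((-1)%:~R) ler_int; lia.
  have : 0 <= #|Vc|%:R :> R by rewrite ler0n.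
  rewrite mE pmulr_lge0 // ltr_pM2r // => r1 d3.
  by have := ler_wpM2r (ltW den0) d3; lra.
have [b4 b5 b6 b7 b8] :=
  length_bounds model (min_distance_set_bound dmin) d_ge4 Vb0.
(* From [d = 8] on the rate would be below 5/8, contrary to [short]. *)
have {b8} d_le7 : (d <= 7)%N by rewrite leqNgt; apply/negP => /b8; lia.
have toR a b : (a * #|Vb| < b * #|Vc|)%N -> a%:R < b%:R * (1 - r).
  by rewrite -(ltr_nat R) !natrM mE mulrA ltr_pM2r.
case: d d_ge4 d_le7 b4 b5 b6 b7 {dmin} => [|[|[|[|[|[|[|[|]]]]]]]] //
  _ _ b4 b5 b6 b7.
- by rewrite ltr_pM2r //; have := toR 1%N 8 ltac:(lia); lra.
- by rewrite ltr_pM2r //; have := toR 1%N 4 ltac:(lia); lra.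
- by rewrite ltr_pM2r //; have := toR 5 16 ltac:(lia); lra.
- by rewrite ltr_pM2r //; have := toR 7 20 ltac:(lia); lra.
Qed.
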